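(* Let $H_0,H_1$ be complex Hilbert spaces and let $C\colon \operatorname{dom}(C)\subseteq H_0\to H_1$ be densely defined and closed with $\operatorname{ran}(C)\subseteq H_1$ closed, such that the embedding $\operatorname{dom}(C)\cap \ker(C)^\bot \hookrightarrow H_0$ is compact. Let $\gamma\in L(H_0)$ with $\operatorname{Re}\gamma\ge0$ be such that there exist a closed subspace $U\subseteq H_0$, a constant $c>0$, and operators $\gamma_U\in L(U)$, $\gamma_{U^\bot}\in L(U^\bot)$ with $\operatorname{Re}\gamma_U\geq c$, $\gamma_{U^\bot}=\gamma_{U^\bot}^*\geq 0$ and $\gamma(x_U+x_{U^\bot})=\gamma_Ux_U+\gamma_{U^\bot}x_{U^\bot}$ for all $x_U\in U$, $x_{U^\bot}\in U^\bot$. Let $$A:=-\begin{pmatrix}\gamma&0\\0&0\end{pmatrix}-\begin{pmatrix}0&-C^*\\ C&0\end{pmatrix},\qquad \operatorname{dom}(A)=\operatorname{dom}(C)\times\operatorname{dom}(C^* )\subseteq H_0\times H_1 .$$ Assume that (a) $\mathrm{i}\lambda-A$ and $\mathrm{i}\lambda-A^*$ are one-to-one for all $\lambda\in\mathbb{R}\setminus\{0\}$; (b) $\kappa_0^*\gamma\kappa_0$ has closed range, where $\kappa_0\colon\ker(C)\hookrightarrow H_0$ is the canonical embedding. Then $A_0:=A|_{\ker(A)^\bot}^{\operatorname{ran}(A)}$ generates a semi-uniformly stable $C_0$-semigroup.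
   Context: $L(X)$ denotes the bounded linear operators on $X$; $\operatorname{Re}\gamma:=\frac12(\gamma+\gamma^* )$. $\operatorname{dom}(C)$ carries the graph norm. $A_0=A|_{\ker(A)^\bot}^{\operatorname{ran}(A)}$ is the operator $A$ with domain restricted to $\operatorname{dom}(A)\cap\ker(A)^\bot$ and codomain $\operatorname{ran}(A)$, considered as an operator in the space $\operatorname{ran}(A)$ (with the norm of $H_0\times H_1$). A $C_0$-semigroup $T$ with generator $G$ is semi-uniformly stable if there exists $f\colon[0,\infty)\to[0,\infty)$ with $f(t)\to0$ as $t\to\infty$ such that $\|T(t)x\|\le f(t)\|x\|_{\operatorname{dom}(G)}$ for all $x\in\operatorname{dom}(G)$ and $t\ge0$, where $\|\cdot\|_{\operatorname{dom}(G)}$ is the graph norm. *)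

(* Defs.v *)
From HB Require Import structures.
From mathcomp Require Import all_boot all_order all_algebra.
From mathcomp Require Import complex.
From mathcomp Require Import all_classical all_reals all_analysis.

Set Implicit Arguments.
Unset Strict Implicit.
Unset Printing Implicit Defensive.

Import Order.TTheory GRing.Theory Num.Theory.
Import numFieldNormedType.Exports.

Local Open Scope classical_set_scope.
Local Open Scope complex_scope.
Local Open Scope ring_scope.

(* Inner products are linear in the first argument and conjugate-linear in the
   second one. *)
HB.mixin Record NormedModule_isPreHilbert (R : realType) H
    & NormedModule R[i] H := {
  inner : {dot H for Num.conj} ;
  sqr_norm_inner : forall x : H, `|x| ^+ 2 = inner x x
}.

#[short(type="preHilbertType")]
HB.structure Definition PreHilbert (R : realType) :=
  {H of NormedModule R[i] H & NormedModule_isPreHilbert R H}.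

#[short(type="hilbertType")]
HB.structure Definition Hilbert (R : realType) :=
  {H of PreHilbert R H & Complete H}.

Section DotNorm.
Context (C : numClosedFieldType) (H : lmodType C) (dot : {dot H for Num.conj}).
Implicit Types x y : H.

Definition dot_norm x : C := sqrtC (dot x x).

Lemma dotJ x y : dot x y = Num.conj (dot y x).
Proof. by rewrite hermC /= expr0 mul1r. Qed.

Lemma dotxx_ge0 x : 0 <= dot x x.
Proof.
have [->|x0] := eqVneq x 0; first by rewrite linear0r.
exact/ltW/neq0_dnorm_gt0.
Qed.

Lemma dot_norm_ge0 x : 0 <= dot_norm x.
Proof. by rewrite sqrtC_ge0 dotxx_ge0. Qed.

Lemma sqr_dot_norm x : dot_norm x ^+ 2 = dot x x.
Proof. exact: sqrtCK. Qed.

Lemma dot_normZ (l : C) x : dot_norm (l *: x) = `|l| * dot_norm x.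
Proof.
apply/eqP; rewrite -(@eqrXn2 _ 2) ?mulr_ge0 ?dot_norm_ge0//; apply/eqP.
by rewrite exprMn !sqr_dot_norm normCK linearZl_LR /= linearZr_LR/= mulrA.
Qed.

Lemma dot_norm_eq0 x : dot_norm x = 0 -> x = 0.
Proof.
move=> nx; apply/eqP/negPn/negP => /(@neq0_dnorm_gt0 _ _ _ dot).
by rewrite -sqr_dot_norm nx expr0n /= ltxx.
Qed.

Lemma dot_cauchy_schwarz x y : `|dot x y| <= dot_norm x * dot_norm y.
Proof.
have [->|y0] := eqVneq y 0.
  by rewrite linear0r normr0 mulr_ge0 ?dot_norm_ge0.
have yy : 0 < dot y y by exact: neq0_dnorm_gt0.
rewrite -(@ler_pXn2r _ 2) ?nnegrE ?mulr_ge0 ?dot_norm_ge0//.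
rewrite exprMn !sqr_dot_norm normCK -dotJ.
pose z := x - (dot x y / dot y y) *: y.
have : 0 <= dot z z by exact: dotxx_ge0.
have -> : dot z z = dot x x - dot x y * dot y x / dot y y.
  have zy : dot z y = 0.
    by rewrite /z linearBl /= linearZl_LR /= divfK ?subrr// gt_eqF.
  rewrite {2}/z linearBr /= linearZr_LR /= zy mulr0 subr0 /z linearBl /=.
  by rewrite linearZl_LR /= mulrAC.
by rewrite subr_ge0 ler_pdivrMr.
Qed.

Lemma ler_dot_normD x y : dot_norm (x + y) <= dot_norm x + dot_norm y.
Proof.
rewrite -(@ler_pXn2r _ 2) ?nnegrE ?addr_ge0 ?dot_norm_ge0//.
rewrite sqrrD !sqr_dot_norm linearDl /= !linearDr /= -!addrA lerD2l !addrA lerD2r.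
have -> : dot x y + dot y x = 'Re (dot x y) *+ 2.
  by rewrite (dotJ y x) -mulr_natr ReE divfK// pnatr_eq0.
rewrite lerMn2r /=; apply: le_trans (dot_cauchy_schwarz x y).
exact: (leif_Re_Creal (dot x y)).1.
Qed.

End DotNorm.

HB.factory Record Lmodule_isPreHilbert (R : realType) H
    & GRing.Lmodule R[i] H := {
  dot : {dot H for Num.conj}
}.

HB.builders Context R H & Lmodule_isPreHilbert R H.
HB.instance Definition _ := Lmodule_isNormed.Build R[i] H
  (ler_dot_normD dot) (dot_normZ dot) (@dot_norm_eq0 _ _ dot).
HB.instance Definition _ :=
  NormedModule_isPreHilbert.Build R H (sqr_dot_norm dot).
HB.end.

(* [X * Y] with the Hilbert norm; the library's instance on [X * Y] carries
   the maximum norm. *)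
Definition hprod (X Y : Type) : Type := (X * Y)%type.

Section HProd.
Context (R : realType) (X Y : preHilbertType R).

HB.instance Definition _ := GRing.Lmodule.copy (hprod X Y) (X * Y)%type.

Definition hprod_dot (p q : hprod X Y) : R[i] :=
  inner p.1 q.1 + inner p.2 q.2.

Lemma hprod_dot_linear :
  bilinear_for ( *%R : R[i] -> R[i] -> R[i]) (Num.conj \; *%R) hprod_dot.
Proof.
split=> p a q r; rewrite /hprod_dot /=.
- by rewrite !linearPl /= mulrDr addrACA.
- by rewrite !linearPr /= mulrDr addrACA.
Qed.

HB.instance Definition _ := bilinear_isBilinear.Build R[i]
  (hprod X Y) (hprod X Y) R[i] *%R (Num.conj \; *%R) hprod_dot
  hprod_dot_linear.

Lemma hprod_dotJ (p q : hprod X Y) :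
  hprod_dot p q = (-1) ^+ false * Num.conj (hprod_dot q p).
Proof. by rewrite expr0 mul1r /hprod_dot rmorphD /= -!dotJ. Qed.

HB.instance Definition _ := isHermitianSesquilinear.Build R[i]
  (hprod X Y) false Num.conj hprod_dot hprod_dotJ.

Lemma hprod_dot_gt0 (p : hprod X Y) : p != 0 -> 0 < hprod_dot p p.
Proof.
case: p => x y p0; rewrite lt_neqAle addr_ge0 ?dotxx_ge0// andbT eq_sym.
apply: contra p0; rewrite /hprod_dot /= paddr_eq0 ?dotxx_ge0//.
by rewrite -!sqr_norm_inner !sqrf_eq0 !normr_eq0 => /andP[/eqP-> /eqP->].
Qed.

HB.instance Definition _ := isDotProduct.Build R[i]
  (hprod X Y) hprod_dot hprod_dot_gt0.

HB.instance Definition _ := Lmodule_isPreHilbert.Build R (hprod X Y) hprod_dot.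

End HProd.

Record lsubspace (K : numFieldType) (V : lmodType K) := LSubspace {
  lsubspace_set :> set V ;
  lsubspace0 : lsubspace_set 0 ;
  lsubspaceP : forall (a : K) x y,
    lsubspace_set x -> lsubspace_set y -> lsubspace_set (a *: x + y)
}.

Definition lsubspace_mem (K : numFieldType) (V : lmodType K) (S : lsubspace V)
  : V -> Prop := lsubspace_set S.
Coercion lsubspace_mem : lsubspace >-> Funclass.

(* A linear subspace, as a space of its own. *)
Section SubspaceType.
Context (R : realType) (X : preHilbertType R) (S : lsubspace X).

Definition subsp_pred : {pred X} := [pred x | x \in (S : set X)].

Lemma subsp_submod_closed : submod_closed subsp_pred.
Proof.
split=> [|a x y]; rewrite !inE; first exact: lsubspace0.
exact: lsubspaceP.
Qed.

HB.instance Definition _ :=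
  GRing.isSubmodClosed.Build R[i] X subsp_pred subsp_submod_closed.

Record subsp := Subsp { subsp_val : X ; _ : subsp_val \in subsp_pred }.

HB.instance Definition _ := [isSub for subsp_val].
HB.instance Definition _ := [Choice of subsp by <:].
HB.instance Definition _ := [SubChoice_isSubLmodule of subsp by <:].

Lemma subsp_valP (a : R[i]) (x y : subsp) :
  subsp_val (a *: x + y) = a *: subsp_val x + subsp_val y.
Proof. exact: (GRing.linearP (\val : subsp -> X)). Qed.

Lemma subsp_val0 : subsp_val 0 = 0.
Proof. exact: (raddf0 (\val : subsp -> X)). Qed.

Definition subsp_dot (x y : subsp) : R[i] := inner (subsp_val x) (subsp_val y).

Lemma subsp_dot_linear :
  bilinear_for ( *%R : R[i] -> R[i] -> R[i]) (Num.conj \; *%R) subsp_dot.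
Proof.
split=> p a q r; rewrite /subsp_dot.
- by rewrite subsp_valP linearPl.
- by rewrite subsp_valP linearPr.
Qed.

HB.instance Definition _ := bilinear_isBilinear.Build R[i]
  subsp subsp R[i] *%R (Num.conj \; *%R) subsp_dot subsp_dot_linear.

Lemma subsp_dotJ (x y : subsp) :
  subsp_dot x y = (-1) ^+ false * Num.conj (subsp_dot y x).
Proof. by rewrite expr0 mul1r /subsp_dot -dotJ. Qed.

HB.instance Definition _ := isHermitianSesquilinear.Build R[i]
  subsp false Num.conj subsp_dot subsp_dotJ.

Lemma subsp_dot_gt0 (x : subsp) : x != 0 -> 0 < subsp_dot x x.
Proof.
move=> x0; apply: neq0_dnorm_gt0; apply: contra x0 => /eqP x0.
apply/eqP/val_inj; rewrite /= x0; exact/esym/subsp_val0.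
Qed.

HB.instance Definition _ := isDotProduct.Build R[i]
  subsp subsp_dot subsp_dot_gt0.

HB.instance Definition _ := Lmodule_isPreHilbert.Build R subsp subsp_dot.

End SubspaceType.

Section Orthogonal.
Context (R : realType) (X : preHilbertType R).

Definition orth_set (S : set X) : set X :=
  [set x | forall y, S y -> inner x y = 0].

Lemma orth0 (S : set X) : orth_set S 0.
Proof. by move=> y _; rewrite linear0l. Qed.

Lemma orthP (S : set X) (a : R[i]) x y :
  orth_set S x -> orth_set S y -> orth_set S (a *: x + y).
Proof.
by move=> Sx Sy z Sz; rewrite linearPl /= Sx// Sy// mulr0 addr0.
Qed.

Definition orth (S : set X) : lsubspace X :=
  @LSubspace _ _ (orth_set S) (@orth0 S) (@orthP S).

End Orthogonal.

(* Bounded linear operators defined on the whole space: L(X, Y). *)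
Record bop (R : realType) (X Y : preHilbertType R) := Bop {
  bop_fun :> {linear X -> Y} ;
  bop_bounded : exists M : R, forall x, `|bop_fun x| <= M%:C * `|x|
}.

Section Embedding.
Context (R : realType) (X : preHilbertType R) (S : lsubspace X).

Let val_bounded :
  exists M : R, forall x : subsp S, `|\val x : X| <= M%:C * `|x|.
Proof.
exists 1 => x; rewrite mul1r -(@ler_pXn2r _ 2) ?nnegrE//.
by rewrite !sqr_norm_inner.
Qed.

Definition embedding : bop (subsp S) X := Bop val_bounded.

End Embedding.

(* A possibly unbounded linear operator is identified with its graph, a linear
   subspace of the product. Single-valuedness, density of the domain, etc. are
   separate hypotheses. *)
Notation linrel X Y := (lsubspace (hprod X Y)).

Section LinearRelations.
Context (R : realType).
Implicit Types X Y Z : preHilbertType R.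

Definition single_valued X Y (A : linrel X Y) :=
  forall x y1 y2, A (x, y1) -> A (x, y2) -> y1 = y2.

Definition one_to_one X Y (A : linrel X Y) :=
  forall x1 x2 y, A (x1, y) -> A (x2, y) -> x1 = x2.

Section DomRanKer.
Context X Y (A : linrel X Y).

Program Definition dom : lsubspace X :=
  @LSubspace _ _ [set x | exists y, A (x, y)] _ _.
Next Obligation. by exists 0; exact: (lsubspace0 A). Qed.
Next Obligation.
by move=> a x y [u Au] [v Av]; exists (a *: u + v); exact: (lsubspaceP a Au Av).
Qed.

Program Definition ran : lsubspace Y :=
  @LSubspace _ _ [set y | exists x, A (x, y)] _ _.
Next Obligation. by exists 0; exact: (lsubspace0 A). Qed.
Next Obligation.
by move=> a x y [u Au] [v Av]; exists (a *: u + v); exact: (lsubspaceP a Au Av).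
Qed.

Program Definition ker : lsubspace X := @LSubspace _ _ [set x | A (x, 0)] _ _.
Next Obligation. exact: (lsubspace0 A). Qed.
Next Obligation.
move=> a x y Ax Ay; have := lsubspaceP a Ax Ay.
by rewrite /= [_ + _](_ : _ = (a *: x + y, a *: 0 + 0))// scaler0 addr0.
Qed.

End DomRanKer.

Program Definition graph X Y (f : bop X Y) : linrel X Y :=
  @LSubspace _ _ [set p : hprod X Y | p.2 = f p.1] _ _.
Next Obligation. by move=> X Y f /=; rewrite linear0. Qed.
Next Obligation. by move=> X Y f a p q /= -> ->; rewrite linearP. Qed.

Program Definition lr_scalar X (a : R[i]) : linrel X X :=
  @LSubspace _ _ [set p : hprod X X | p.2 = a *: p.1] _ _.
Next Obligation. by move=> X a /=; rewrite scaler0. Qed.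
Next Obligation.
by move=> X a b p q /= -> ->; rewrite scalerDr !scalerA mulrC.
Qed.

Program Definition lr_zero X Y : linrel X Y :=
  @LSubspace _ _ [set p : hprod X Y | p.2 = 0] _ _.
Next Obligation. by []. Qed.
Next Obligation. by move=> X Y a p q /= -> ->; rewrite scaler0 addr0. Qed.

Program Definition lr_scale X Y (a : R[i]) (A : linrel X Y) : linrel X Y :=
  @LSubspace _ _
    [set p : hprod X Y | exists2 y, A (p.1, y) & p.2 = a *: y] _ _.
Next Obligation.
by move=> X Y a A; exists 0; [exact: (lsubspace0 A)|rewrite scaler0].
Qed.
Next Obligation.
move=> X Y a A b p q /= [y Ay ->] [z Az ->]; exists (b *: y + z).
  exact: (lsubspaceP b Ay Az).
by rewrite scalerDr !scalerA mulrC.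
Qed.

Definition lr_opp X Y (A : linrel X Y) : linrel X Y := lr_scale (-1) A.

(* As for unbounded operators, the domain is the intersection of the domains. *)
Program Definition lr_add X Y (A B : linrel X Y) : linrel X Y :=
  @LSubspace _ _ [set p : hprod X Y |
    exists y z, [/\ A (p.1, y), B (p.1, z) & p.2 = y + z]] _ _.
Next Obligation.
move=> X Y A B; exists 0, 0; split; last by rewrite addr0.
- exact: (lsubspace0 A).
- exact: (lsubspace0 B).
Qed.
Next Obligation.
move=> X Y A B a p q /= [y [z [Ay Bz ->]]] [y' [z' [Ay' Bz' ->]]].
exists (a *: y + y'), (a *: z + z'); split.
- exact: (lsubspaceP a Ay Ay').
- exact: (lsubspaceP a Bz Bz').
- by rewrite scalerDr addrACA.
Qed.

Program Definition lr_comp X Y Z (B : linrel Y Z) (A : linrel X Y) :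
    linrel X Z :=
  @LSubspace _ _
    [set p : hprod X Z | exists2 y, A (p.1, y) & B (y, p.2)] _ _.
Next Obligation.
by move=> X Y Z B A; exists 0; [exact: (lsubspace0 A)|exact: (lsubspace0 B)].
Qed.
Next Obligation.
move=> X Y Z B A a p q /= [y Ay By] [z Az Bz]; exists (a *: y + z).
  exact: (lsubspaceP a Ay Az).
exact: (lsubspaceP a By Bz).
Qed.

(* The operator matrix (A11 A12; A21 A22). The domain is
   (dom A11 `&` dom A21) `*` (dom A12 `&` dom A22). *)
Program Definition lr_block X1 X2 Y1 Y2
    (A11 : linrel X1 Y1) (A12 : linrel X2 Y1)
    (A21 : linrel X1 Y2) (A22 : linrel X2 Y2) :
    linrel (hprod X1 X2) (hprod Y1 Y2) :=
  @LSubspace _ _ [set p : hprod (hprod X1 X2) (hprod Y1 Y2) |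
    exists u11 u12 u21 u22,
      [/\ A11 (p.1.1, u11), A12 (p.1.2, u12),
          A21 (p.1.1, u21), A22 (p.1.2, u22) &
          p.2 = (u11 + u12, u21 + u22)]] _ _.
Next Obligation.
move=> X1 X2 Y1 Y2 A11 A12 A21 A22; exists 0, 0, 0, 0; split.
- exact: (lsubspace0 A11).
- exact: (lsubspace0 A12).
- exact: (lsubspace0 A21).
- exact: (lsubspace0 A22).
- by rewrite !addr0.
Qed.
Next Obligation.
move=> X1 X2 Y1 Y2 A11 A12 A21 A22 a p q /=.
move=> [u11 [u12 [u21 [u22 [h11 h12 h21 h22 ->]]]]].
move=> [v11 [v12 [v21 [v22 [k11 k12 k21 k22 ->]]]]].
exists (a *: u11 + v11), (a *: u12 + v12), (a *: u21 + v21), (a *: u22 + v22).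
split.
- exact: (lsubspaceP a h11 k11).
- exact: (lsubspaceP a h12 k12).
- exact: (lsubspaceP a h21 k21).
- exact: (lsubspaceP a h22 k22).
- by congr pair => /=; rewrite scalerDr addrACA.
Qed.

(* (y, x) belongs to the adjoint when <A u, y> = <u, x> for all u in dom A.
   This is the graph of an operator when dom A is dense. *)
Program Definition adjoint X Y (A : linrel X Y) : linrel Y X :=
  @LSubspace _ _ [set p : hprod Y X |
    forall u v, A (u, v) -> inner v p.1 = inner u p.2] _ _.
Next Obligation. by move=> X Y A u v _ /=; rewrite !linear0r. Qed.
Next Obligation.
move=> X Y A a p q /= pA qA u v Auv.
by rewrite !linearPr /= (pA _ _ Auv) (qA _ _ Auv).
Qed.

(* For A in L(X) with X complete, dom (adjoint A) is the whole of X. *)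
Definition lr_Re X (A : linrel X X) : linrel X X :=
  lr_scale 2^-1 (lr_add A (adjoint A)).

(* A >= c in the sense of quadratic forms. In the order of R[i], a <= b also
   says that b - a is real. *)
Definition lr_ge X (A : linrel X X) (c : R) :=
  forall x y, A (x, y) -> c%:C * inner x x <= inner y x.

(* The part of A with domain restricted to S, as an operator in V. *)
Program Definition lr_part X (A : linrel X X) (S V : lsubspace X) :
    linrel (subsp V) (subsp V) :=
  @LSubspace _ _ [set p : hprod (subsp V) (subsp V) |
    S (subsp_val p.1) /\ A (subsp_val p.1, subsp_val p.2)] _ _.
Next Obligation.
move=> X A S V.
change (S (@subsp_val _ _ V 0) /\ A (@subsp_val _ _ V 0, @subsp_val _ _ V 0)).
rewrite !subsp_val0.
by split; [exact: lsubspace0|exact: (lsubspace0 A)].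
Qed.
Next Obligation.
move=> X A S V a p q [Sp Ap] [Sq Aq].
change (S (subsp_val (a *: p.1 + q.1)) /\
  A (subsp_val (a *: p.1 + q.1), subsp_val (a *: p.2 + q.2))).
rewrite !subsp_valP.
by split; [exact: lsubspaceP|exact: (lsubspaceP a Ap Aq)].
Qed.

(* dom A `&` S, with the graph norm, is compactly embedded: the unit ball is
   relatively compact in X. The norm of hprod X Y is the graph norm. *)
Definition compactly_embedded X Y (A : linrel X Y) (S : set X) :=
  precompact [set x | S x /\
    exists2 y, A (x, y) & `|(x, y) : hprod X Y| <= 1].

(* The values of T at negative times are irrelevant. *)
Record C0_semigroup X (T : R -> bop X X) : Prop := {
  C0_semigroup0 : forall x, T 0 x = x ;
  C0_semigroupD : forall s t : R, 0 <= s -> 0 <= t ->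
    forall x, T (s + t) x = T s (T t x) ;
  C0_semigroup_cvg : forall x, T t x @[t --> 0^'+] --> x
}.

Program Definition generator X (T : R -> bop X X) : linrel X X :=
  @LSubspace _ _ [set p : hprod X X |
    (h^-1)%:C *: (T h p.1 - p.1) @[h --> 0^'+] --> p.2] _ _.
Next Obligation.
move=> X T /=; rewrite [X in X @ _](_ : _ = fun=> 0); first exact: cvg_cst.
by apply/funext => h; rewrite linear0 subrr scaler0.
Qed.
Next Obligation.
move=> X T a p q /= Tp Tq.
rewrite [F in F @ _](_ : _ = fun h => a *: ((h^-1)%:C *: (T h p.1 - p.1))
  + (h^-1)%:C *: (T h q.1 - q.1)).
  by apply: cvgD => //; exact: cvgZl_tmp.
apply/funext => h; rewrite linearP scalerA [a * _]mulrC -scalerA -scalerDr.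
by rewrite [a *: (_ - _)]scalerBr addrACA -opprD.
Qed.

Definition semi_uniformly_stable X (T : R -> bop X X) :=
  exists f : R -> R,
    [/\ forall t : R, 0 <= t -> 0 <= f t,
        f t @[t --> +oo] --> 0 &
        forall t : R, 0 <= t -> forall x y, generator T (x, y) ->
          `|T t x| <= (f t)%:C * `|(x, y) : hprod X X|].

End LinearRelations.

Section System.
Context (R : realType) (H0 H1 : preHilbertType R).
Context (C : linrel H0 H1) (gamma : bop H0 H0).

(* - (gamma 0; 0 0) - (0 -C^*; C 0) *)
Definition opA : linrel (hprod H0 H1) (hprod H0 H1) :=
  lr_add
    (lr_opp (lr_block (graph gamma) (lr_zero H1 H0)
                      (lr_zero H0 H1) (lr_zero H1 H1)))
    (lr_opp (lr_block (lr_zero H0 H0) (lr_opp (adjoint C))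
                      C (lr_zero H1 H1))).

Definition opA0 : linrel (subsp (ran opA)) (subsp (ran opA)) :=
  lr_part opA (orth (ker opA)) (ran opA).

End System.

(* Main.v *)
Require Import Defs.
From HB Require Import structures.
From mathcomp Require Import all_boot all_order all_algebra.
From mathcomp Require Import complex.
From mathcomp Require Import all_classical all_reals all_analysis.
From mathcomp Require Import ring lra.

Set Implicit Arguments.
Unset Strict Implicit.
Unset Printing Implicit Defensive.

Import Order.TTheory GRing.Theory Num.Theory.
Import numFieldNormedType.Exports.

Local Open Scope classical_set_scope.
Local Open Scope complex_scope.
Local Open Scope ring_scope.

(** The real part of [inner (A z) z] is minus the dissipated energy, the real
    part of [inner (gamma u) u], for [z = (u, v)]. By the splitting of [gamma]
    this energy controls [gamma u] itself ([damping_bounds]), so [gamma] and its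
    adjoint have the same kernel and the kernel of [A] is that of its adjoint.
    Therefore [ran A] is contained in the orthogonal complement of [ker A].

    Everything rests on one compactness property, [opA_compact]: a sequence
    orthogonal to [ker A] that is bounded in the graph norm of [A] and whose
    dissipated energy tends to zero has a convergent subsequence. The part of
    [u n] orthogonal to [ker C] is taken care of by the compact embedding, the
    part [v n] by the same embedding and duality. The remaining part of [u n] lies
    in [ker C], where nothing is compact; but there [gamma] is bounded below, away
    from its kernel, because its compression has closed range ([gamma_below]), and
    [gamma (u n)] tends to zero. Two applications of this property give the
    theorem.

    First, it bounds [A] below on the complement of [ker A] ([opA_below]). Hence
    [ran A] is closed and equals this complement, and the part [A_0] of [A] in it
    has a bounded inverse. As [A_0] is maximal dissipative, it generates a
    contraction semigroup [T] ([lumer_phillips]; the semigroup is the limit of the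
    implicit Euler schemes with step sizes [2 ^- k]).

    Secondly, suppose that the decay on the unit ball of the domain is not
    uniform ([uniform_decay]). Then there are trajectories in this ball that keep
    almost all of their energy, bounded away from zero, over longer and longer
    times. The dissipated energy is small at some moment of each, so compactness
    yields in the limit a nonzero vector on which [T] is isometric. On the
    subspace of all such vectors the inverse of [A_0] is skew-adjoint and, by
    compactness again, compact ([isometric_eq0]). So it has a nonzero eigenvalue,
    which is imaginary: this contradicts the injectivity of [i lambda - A]. *)

(** * Real-valued norm and inner product *)

Lemma linear_coef_eq0 (R : realType) (b c : R) :
  0 <= c -> (forall a, 0 <= a * b + a ^+ 2 * c) -> b = 0.
Proof.
move=> c0 /(_ (- b / (c + 1))).
have c1 : c + 1 != 0 by rewrite gt_eqF// ltr_wpDl.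
set t := - b / (c + 1) => H.
have bt : b = - t * (c + 1) by rewrite /t; field.
suff t0 : t = 0 by rewrite bt t0 oppr0 mul0r.
have t2 : 0 <= t ^+ 2 by exact: sqr_ge0.
move: H; rewrite {1}bt => H.
have : t ^+ 2 <= 0 by lra.
by move=> tl; apply/eqP; rewrite -sqrf_eq0 eq_le t2 tl.
Qed.

Section RealPart.
Context (R : realType) (X : preHilbertType R).
Implicit Types x y z : X.

Definition rnorm x : R := complex.Re `|x|.

Definition rdot x y : R := complex.Re (inner x y).

Lemma normE x : `|x| = (rnorm x)%:C.
Proof. by rewrite /rnorm RRe_real// normr_real. Qed.

Lemma rnorm_ge0 x : 0 <= rnorm x.
Proof. by rewrite -ler0c -normE. Qed.

Lemma rnormK x : rnorm x ^+ 2 = rdot x x.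
Proof. by rewrite /rdot -sqr_norm_inner normE -rmorphXn. Qed.

Lemma rnorm0 : rnorm 0 = 0.
Proof. by rewrite /rnorm normr0. Qed.

Lemma rnorm0_eq0 x : rnorm x = 0 -> x = 0.
Proof. by move=> x0; apply: normr0_eq0; rewrite normE x0. Qed.

Lemma rnormD x y : rnorm (x + y) <= rnorm x + rnorm y.
Proof. by rewrite -lecR rmorphD/= -!normE ler_normD. Qed.

Lemma rnormN x : rnorm (- x) = rnorm x.
Proof. by rewrite /rnorm normrN. Qed.

Lemma rnormBC x y : rnorm (x - y) = rnorm (y - x).
Proof. by rewrite -rnormN opprB. Qed.

Lemma rnormB_le x y : rnorm x <= rnorm y + rnorm (x - y).
Proof. by rewrite -{1}(subrKC y x) rnormD. Qed.

Lemma rnormZc (a : R[i]) x : rnorm (a *: x) = complex.Re `|a| * rnorm x.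
Proof.
apply: complexI; rewrite -normE normrZ rmorphM/= -normE; congr (_ * _).
Qed.

Lemma rnormZ (a : R) x : rnorm (a%:C *: x) = `|a| * rnorm x.
Proof. by rewrite rnormZc normc_def/= expr0n addr0 sqrtr_sqr. Qed.

Lemma rdotC x y : rdot x y = rdot y x.
Proof. by rewrite /rdot (dotJ inner x y); case: (inner y x). Qed.

Lemma rdotDl x y z : rdot (x + y) z = rdot x z + rdot y z.
Proof. by rewrite /rdot linearDl raddfD. Qed.

Lemma rdotNl x z : rdot (- x) z = - rdot x z.
Proof. by rewrite /rdot linearNl raddfN. Qed.

Lemma rdot0l z : rdot 0 z = 0.
Proof. by rewrite /rdot linear0l. Qed.

Lemma rdotZl (a : R) x z : rdot (a%:C *: x) z = a * rdot x z.
Proof.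
by rewrite /rdot linearZl_LR/=; case: (inner x z) => b c /=; rewrite mul0r subr0.
Qed.

Lemma rdotDr x y z : rdot z (x + y) = rdot z x + rdot z y.
Proof. by rewrite !(rdotC z) rdotDl. Qed.

Lemma rdotNr x z : rdot z (- x) = - rdot z x.
Proof. by rewrite !(rdotC z) rdotNl. Qed.

Lemma rdot0r z : rdot z 0 = 0.
Proof. by rewrite rdotC rdot0l. Qed.

Lemma rdotZr (a : R) x z : rdot z (a%:C *: x) = a * rdot z x.
Proof. by rewrite !(rdotC z) rdotZl. Qed.

Definition rdotE := (rdotDl, rdotDr, rdotNl, rdotNr, rdotZl, rdotZr, rdot0l, rdot0r).

Lemma rdotZil x z : rdot ('i%C *: x) z = - complex.Im (inner x z).
Proof.
by rewrite /rdot linearZl_LR/=; case: (inner x z) => b c /=; rewrite mul0r mul1r add0r.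
Qed.

Lemma rdotii x z : rdot ('i%C *: x) ('i%C *: z) = rdot x z.
Proof.
rewrite /rdot linearZl_LR linearZr_LR/=; case: (inner x z) => b c /=; ring.
Qed.

Lemma rdotZir x z : rdot x ('i%C *: z) = - rdot ('i%C *: x) z.
Proof.
by rewrite -[LHS]rdotii scalerA -expr2 sqr_i scaleN1r rdotNr.
Qed.

Lemma innerE x z : inner x z = Complex (rdot x z) (- rdot ('i%C *: x) z).
Proof. by rewrite rdotZil opprK /rdot; case: (inner x z). Qed.

Lemma inner_eq0 x z : rdot x z = 0 -> rdot ('i%C *: x) z = 0 -> inner x z = 0.
Proof. by rewrite innerE => -> ->; rewrite oppr0. Qed.

Lemma rdot_ge0 x : 0 <= rdot x x.
Proof. by rewrite -rnormK sqr_ge0. Qed.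

Lemma rdot_eq0 x : rdot x x = 0 -> x = 0.
Proof.
by rewrite -rnormK => /eqP; rewrite sqrf_eq0 => /eqP/rnorm0_eq0.
Qed.

Lemma rdot_ext x y : (forall w, rdot x w = rdot y w) -> x = y.
Proof.
move=> xy; apply/eqP; rewrite -subr_eq0; apply/eqP/rdot_eq0.
by rewrite rdotDl rdotNl xy subrr.
Qed.

Lemma rdot_norm x y : `|rdot x y| <= rnorm x * rnorm y.
Proof.
rewrite -lecR rmorphM/= -!normE.
apply: le_trans (_ : `|inner x y| <= _).
  rewrite normc_def lecR innerE /= -sqrtr_sqr ler_wsqrtr//.
  by rewrite lerDl sqr_ge0.
have := dot_cauchy_schwarz (@inner R X) x y.
suff dn (z : X) : dot_norm inner z = `|z| by rewrite !dn.
by rewrite /dot_norm -sqr_norm_inner sqrCK.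
Qed.

Lemma rdot_le x y : rdot x y <= rnorm x * rnorm y.
Proof. exact: le_trans (ler_norm _) (rdot_norm x y). Qed.

Lemma ler_rnorm x y : (rnorm x <= rnorm y) = (rdot x x <= rdot y y).
Proof. by rewrite -!rnormK ler_pXn2r// nnegrE rnorm_ge0. Qed.

Lemma rnorm_distl x y : `|rnorm x - rnorm y| <= rnorm (x - y).
Proof.
have := rnormB_le x y; have := rnormB_le y x; rewrite (rnormBC y x).
by rewrite ler_norml; lra.
Qed.

Lemma parallelogram x y :
  rnorm (x + y) ^+ 2 + rnorm (x - y) ^+ 2
  = 2 * rnorm x ^+ 2 + 2 * rnorm y ^+ 2.
Proof. by rewrite !rnormK !rdotE (rdotC y x); ring. Qed.

End RealPart.

(** Vectors are determined by their real inner products, which turns an identity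
    with real scalars into a family of identities in the field [R]. *)
Ltac vector_ring := by apply: rdot_ext => ?; rewrite !rdotE; ring.

Ltac vector_field := by apply: rdot_ext => ?; rewrite !rdotE; field.

Lemma rnorm_subsp (R : realType) (X : preHilbertType R) (S : lsubspace X)
  (x : subsp S) : rnorm (subsp_val x) = rnorm x.
Proof.
apply/eqP; rewrite -(@eqrXn2 _ 2) ?rnorm_ge0//.
by rewrite !rnormK.
Qed.

Lemma rnorm_hprod (R : realType) (X Y : preHilbertType R) (p : hprod X Y) :
  rnorm p ^+ 2 = rnorm p.1 ^+ 2 + rnorm p.2 ^+ 2.
Proof. by rewrite !rnormK /rdot -raddfD. Qed.

Lemma rnorm_hprod_le (R : realType) (X Y : preHilbertType R) (p : hprod X Y) :
  [/\ rnorm p.1 <= rnorm p, rnorm p.2 <= rnorm p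
    & rnorm p <= rnorm p.1 + rnorm p.2].
Proof.
have := rnorm_hprod p.
have := rnorm_ge0 p; have := rnorm_ge0 p.1; have := rnorm_ge0 p.2.
by move=> *; split; nra.
Qed.

(** * Convergence, completeness and orthogonal projections *)

Section Convergence.
Context (R : realType) (X : preHilbertType R).
Implicit Types (x y z : X) (u v : nat -> X).

Lemma cvg_rnorm_lt {T : Type} {F : set_system T} {FF : Filter F} (f : T -> X) y :
  f @ F --> y <-> forall e : R, 0 < e -> \forall t \near F, rnorm (f t - y) < e.
Proof.
rewrite cvgrPdistC_lt; split=> fy e e0.
  have e0' : 0 < e%:C by rewrite ltcR.
  have := fy _ e0'.
  by apply: filterS => t; rewrite normE ltcR.
have eE : e = (complex.Re e)%:C by rewrite RRe_real// gtr0_real.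
have e0' : 0 < complex.Re e by rewrite -ltcR -eE.
by have := fy _ e0'; apply: filterS => t; rewrite normE eE ltcR.
Qed.

Lemma cvg_rnormP {T : Type} {F : set_system T} {FF : Filter F} (f : T -> X) y :
  f @ F --> y <-> (fun t => rnorm (f t - y)) @ F --> (0 : R).
Proof.
rewrite cvg_rnorm_lt cvgr0Pnorm_lt; split=> fy e /fy;
  by apply: filterS => t; rewrite ger0_norm ?rnorm_ge0.
Qed.

Lemma cvg_seq_lt u x : u @ \oo --> x <->
  forall e : R, 0 < e -> exists N, forall n, (N <= n)%N -> rnorm (u n - x) < e.
Proof.
rewrite cvg_rnorm_lt; split=> ux e /ux.
  by move=> [N _ NP]; exists N => n Nn; exact: NP.
by move=> [N NP]; exists N => // n; exact: NP.
Qed.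

Lemma cvg_seq_squeeze u x (a : nat -> R) :
  a @ \oo --> (0 : R) -> (forall n, rnorm (u n - x) <= a n) -> u @ \oo --> x.
Proof.
move=> a0 ua; apply/cvg_rnormP; apply: (squeeze_cvgr _ (cvg_cst 0) a0).
by apply: nearW => n; rewrite rnorm_ge0 ua.
Qed.

Lemma cvg_rnorm {T : Type} {F : set_system T} {FF : Filter F} (f : T -> X) y :
  f @ F --> y -> (fun t => rnorm (f t)) @ F --> rnorm y.
Proof.
move=> /cvg_rnorm_lt fy; apply/cvgrPdistC_lt => e /fy; apply: filterS => t.
exact: le_lt_trans (rnorm_distl _ _).
Qed.

Lemma cvg_sqr_rnorm {T : Type} {F : set_system T} {FF : Filter F}
    (f : T -> X) y :
  f @ F --> y -> (fun t => rnorm (f t) ^+ 2) @ F --> rnorm y ^+ 2.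
Proof.
move=> /cvg_rnorm fy; rewrite expr2.
by under eq_fun do rewrite expr2; exact: cvgM.
Qed.

Lemma cvg_rdot {T : Type} {F : set_system T} {FF : Filter F} (f : T -> X) y z :
  f @ F --> y -> (fun t => rdot (f t) z) @ F --> rdot y z.
Proof.
move=> /cvg_rnorm_lt fy; apply/cvgrPdistC_lt => e e0.
have z0 : 0 < rnorm z + 1 by rewrite ltr_wpDl ?rnorm_ge0.
have /fy : 0 < e / (rnorm z + 1) by rewrite divr_gt0.
apply: filterS => t; rewrite ltr_pdivlMr// => fe.
rewrite -[X in `|_ - X|]opprK -rdotNl opprK -rdotDl.
apply: le_lt_trans (rdot_norm _ _) _; apply: le_lt_trans fe.
by rewrite ler_wpM2l ?rnorm_ge0// lerDl.
Qed.

(** Reindexing by [k] with [n <= k n] preserves limits along [\oo]; such a [k]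
    need not be increasing, and these reindexings compose. *)
Lemma cvg_subseq {T : topologicalType} (w : nat -> T) (k : nat -> nat) (x : T) :
  (forall n, (n <= k n)%N) -> w @ \oo --> x -> (w \o k) @ \oo --> x.
Proof.
move=> kn wx; apply: cvg_comp wx => P [N _ NP]; exists N => // n /= Nn.
by apply: NP => /=; exact: leq_trans (kn n).
Qed.

Lemma seq_closed (S : set X) :
  (forall u x, (forall n, S (u n)) -> u @ \oo --> x -> S x) -> closed S.
Proof.
move=> clS x xS.
have /choice[u uP] (n : nat) : exists y, S y /\ rnorm (y - x) < n.+1%:R^-1.
  have n0 : 0 < (n.+1%:R^-1 : R)%:C by rewrite ltcR invr_gt0.
  have [y [Sy]] := xS _ (nbhsx_ballx x (PosNum n0)%:num n0).
  rewrite -ball_normE/= normE ltcR rnormBC => yx.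
  by exists y.
apply: (clS u x); first by move=> n; have [] := uP n.
apply: (cvg_seq_squeeze (@cvg_harmonic R)) => n.
by apply: ltW; have [] := uP n.
Qed.

Lemma closed_seq (S : set X) u x :
  closed S -> (forall n, S (u n)) -> u @ \oo --> x -> S x.
Proof. by move=> cS Su; apply: (closed_cvg S cS); exact: nearW. Qed.

Definition seq_cauchy u := forall e : R, 0 < e ->
  exists N, forall m n, (N <= m)%N -> (N <= n)%N -> rnorm (u m - u n) < e.

Lemma cvg_seq_cauchy u x : u @ \oo --> x -> seq_cauchy u.
Proof.
move=> /cvg_seq_lt ux e e0; have /ux[N NP] : 0 < e / 2 by lra.
exists N => m n /NP um /NP un.
rewrite (_ : u m - u n = (u m - x) - (u n - x)); last by vector_ring.
have := rnormD (u m - x) (- (u n - x)); rewrite (rnormN (u n - x)); lra.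
Qed.

End Convergence.

(** Completeness as a property, so that it also applies to the spaces [subsp S]
    and [hprod X Y], whose types carry no completeness structure. *)
Definition seq_complete (R : realType) (X : preHilbertType R) :=
  forall u : nat -> X, seq_cauchy u -> exists x : X, u @ \oo --> x.

Section CauchyCriterion.
Context (R : realType) (X : preHilbertType R).

Lemma seq_cauchy_rate (u : nat -> X) (a : nat -> R) :
  a @ \oo --> (0 : R) ->
  (forall m n, (m <= n)%N -> rnorm (u n - u m) <= a m) -> seq_cauchy u.
Proof.
move=> /cvgr0Pnorm_lt a0 ua e e0; have [N _ NP] := a0 _ e0.
exists N => m n Nm Nn; wlog mn : m n Nm Nn / (m <= n)%N.
  by move=> H; have [/H|/ltnW/H] := leqP m n; rewrite 1?rnormBC; apply.
rewrite rnormBC; apply: le_lt_trans (ua _ _ mn) _.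
by apply: le_lt_trans (ler_norm _) _; exact: NP.
Qed.

End CauchyCriterion.

Lemma hilbert_complete (R : realType) (H : hilbertType R) : seq_complete H.
Proof.
move=> u uc; apply/cvg_ex; apply: cauchy_cvg; apply/cauchyP => /= e e0.
have eE : e = (complex.Re e)%:C by rewrite RRe_real// gtr0_real.
have [N NP] := uc (complex.Re e) ltac:(by rewrite -ltcR -eE).
exists (u N), N => // n /= Nn; rewrite -ball_normE/= normE eE ltcR.
exact: NP.
Qed.

Section HProd.
Context (R : realType) (X Y : preHilbertType R).

Lemma cvg_hprod (p : nat -> hprod X Y) (q : hprod X Y) :
  p @ \oo --> q <->
  (fun n => (p n).1) @ \oo --> q.1 /\ (fun n => (p n).2) @ \oo --> q.2.
Proof.
rewrite !cvg_rnormP; split=> [pq|[p1 p2]].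
  by split; apply: (squeeze_cvgr _ (cvg_cst 0) pq); apply: nearW => n;
    rewrite rnorm_ge0/=; have [] := rnorm_hprod_le (p n - q).
have pq : (fun n => rnorm ((p n).1 - q.1) + rnorm ((p n).2 - q.2)) @ \oo
    --> (0 : R).
  by rewrite -[X in _ --> X]addr0; exact: cvgD.
apply: (squeeze_cvgr _ (cvg_cst 0) pq); apply: nearW => n.
by rewrite rnorm_ge0/=; have [] := rnorm_hprod_le (p n - q).
Qed.

Lemma hprod_complete : seq_complete X -> seq_complete Y ->
  seq_complete (hprod X Y).
Proof.
move=> cX cY p pc.
have /cX[x xP] : seq_cauchy (fun n => (p n).1).
  move=> e /pc[N NP]; exists N => m n Nm Nn; apply: le_lt_trans (NP m n Nm Nn).
  by have [] := rnorm_hprod_le (p m - p n).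
have /cY[y yP] : seq_cauchy (fun n => (p n).2).
  move=> e /pc[N NP]; exists N => m n Nm Nn; apply: le_lt_trans (NP m n Nm Nn).
  by have [] := rnorm_hprod_le (p m - p n).
by exists (x, y); apply/cvg_hprod.
Qed.

End HProd.

Section Subspaces.
Context (R : realType) (X : preHilbertType R) (S : lsubspace X).

Lemma lsubspaceZ (a : R[i]) x : S x -> S (a *: x).
Proof. by move=> Sx; rewrite -[_ *: _]addr0; apply: lsubspaceP (lsubspace0 S). Qed.

Lemma lsubspaceD x y : S x -> S y -> S (x + y).
Proof. by rewrite -{2}[x]scale1r; exact: lsubspaceP. Qed.

Lemma lsubspaceN x : S x -> S (- x).
Proof. by rewrite -scaleN1r; exact: lsubspaceZ. Qed.

Lemma lsubspaceB x y : S x -> S y -> S (x - y).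
Proof. by move=> Sx Sy; exact/lsubspaceD/lsubspaceN. Qed.

Lemma subsp_valS (x : subsp S) : S (subsp_val x).
Proof. by case: x => x /=; rewrite /subsp_pred !inE. Qed.

Lemma subsp_ex x : S x -> exists y : subsp S, subsp_val y = x.
Proof.
move=> Sx; have Sx' : x \in subsp_pred S by rewrite !inE.
by exists (Subsp Sx').
Qed.

Lemma subsp_valI (x y : subsp S) : subsp_val x = subsp_val y -> x = y.
Proof. exact: val_inj. Qed.

Lemma subsp_valB (x y : subsp S) : subsp_val (x - y) = subsp_val x - subsp_val y.
Proof. exact: (raddfB (\val : subsp S -> X)). Qed.

Lemma subsp_valZ (a : R[i]) (x : subsp S) : subsp_val (a *: x) = a *: subsp_val x.
Proof. by rewrite -[a *: x]addr0 subsp_valP subsp_val0 addr0. Qed.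

Lemma cvg_subsp {T : Type} {F : set_system T} {FF : Filter F}
    (f : T -> subsp S) (x : subsp S) :
  f @ F --> x <-> (fun t => subsp_val (f t)) @ F --> subsp_val x.
Proof.
rewrite !cvg_rnormP.
by under [X in _ <-> (X @ _ --> _)]eq_fun do rewrite -subsp_valB rnorm_subsp.
Qed.

Lemma subsp_complete :
  seq_complete X -> closed (S : set X) -> seq_complete (subsp S).
Proof.
move=> cX cS u uc.
have /cX[x ux] : seq_cauchy (fun n => subsp_val (u n)).
  move=> e /uc[N NP]; exists N => m n Nm Nn; rewrite -subsp_valB rnorm_subsp.
  exact: NP.
have /subsp_ex[y yx] : S x.
  by apply: closed_seq cS _ ux => n; exact: subsp_valS.
by exists y; apply/cvg_subsp; rewrite yx.
Qed.

(** A complex subspace is closed under multiplication by the imaginary unit, so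
    that orthogonality can be tested on real parts. *)
Lemma orth_rdot x : orth S x <-> forall y, S y -> rdot x y = 0.
Proof.
split=> xS y Sy; first by rewrite /rdot xS.
apply: inner_eq0; first exact: xS.
apply/eqP; rewrite -oppr_eq0 -rdotZir; apply/eqP/xS.
exact: lsubspaceZ.
Qed.

Lemma orth_closed : closed (orth S : set X).
Proof.
apply: seq_closed => u x uS ux; apply/orth_rdot => y Sy.
apply: cvg_unique (cvg_rdot (z := y) ux) _ => //.
rewrite (_ : (fun _ => _) = fun=> 0); first exact: cvg_cst.
by apply/funext => n; have /orth_rdot := uS n; exact.
Qed.

Lemma orth_self x : S x -> orth S x -> x = 0.
Proof. by move=> Sx /orth_rdot /(_ _ Sx) /rdot_eq0. Qed.

End Subspaces.

Section Projection.
Context (R : realType) (X : preHilbertType R) (S : lsubspace X).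
Hypothesis cX : seq_complete X.

(** A minimizing sequence for the distance to [S] is Cauchy by the parallelogram
    law; its limit is the projection onto the closure of [S]. *)
Lemma projection_seq x : exists (s : nat -> X) (p : X),
  [/\ forall n, S (s n), s @ \oo --> p & orth S (x - p)].
Proof.
pose E : set R := [set rnorm (x - s) ^+ 2 | s in (S : set X)].
have E0 : E !=set0 by exists (rnorm (x - 0) ^+ 2), 0 => //; exact: lsubspace0.
have Elb : has_lbound E by exists 0 => _ [s _ <-]; exact: sqr_ge0.
have infE s : S s -> inf E <= rnorm (x - s) ^+ 2.
  by move=> Ss; apply: ge_inf => //; exists s.
have /choice[s sP] (n : nat) :
    exists s, S s /\ rnorm (x - s) ^+ 2 < inf E + n.+1%:R^-1.
  have n0 : 0 < n.+1%:R^-1 :> R by rewrite invr_gt0.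
  have [_ [s Ss <-] sE] := inf_adherent n0 (conj E0 Elb).
  by exists s.
have Ss n : S (s n) by have [] := sP n.
have dist m n : rnorm (s m - s n) ^+ 2 <= 2 * (m.+1%:R^-1 + n.+1%:R^-1).
  have := parallelogram (x - s m) (x - s n).
  have -> : x - s m - (x - s n) = s n - s m by vector_ring.
  have -> : x - s m + (x - s n) = 2%:C *: (x - 2^-1%:C *: (s m + s n)).
    by vector_field.
  rewrite rnormZ exprMn (rnormBC (s n)) (ger0_norm (ler0n _ 2)) => pl.
  have := infE (2^-1%:C *: (s m + s n)) ltac:(exact/lsubspaceZ/lsubspaceD).
  have [_ sm] := sP m; have [_ sn] := sP n => sE.
  move: sm sn pl sE; set a := m.+1%:R^-1; set b := n.+1%:R^-1; lra.
have [p sp] : exists p : X, s @ \oo --> p.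
  apply: (cX (u := s)) => e e0.
  have e4 : 0 < e ^+ 2 / 4 by rewrite divr_gt0 ?exprn_gt0.
  have [N _ NP] := cvgr0_norm_lt _ (@cvg_harmonic R) _ e4.
  exists N => m n /NP + /NP; rewrite /harmonic/= !ger0_norm ?invr_ge0// => mN nN.
  rewrite -(@ltr_pXn2r _ 2) ?nnegrE ?rnorm_ge0 ?ltW//.
  by move: mN nN (dist m n); set a := m.+1%:R^-1; set b := n.+1%:R^-1; lra.
exists s, p; split=> //.
apply/orth_rdot => y Sy; set o := x - p.
have xs : (fun n => x - s n) @ \oo --> o by apply: cvgB => //; exact: cvg_cst.
have oE : rnorm o ^+ 2 <= inf E.
  have hh : (fun n => inf E + n.+1%:R^-1) @ \oo --> inf E.
    by rewrite -[X in _ --> X]addr0; apply: cvgD (@cvg_harmonic R); exact: cvg_cst.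
  apply: ler_cvg_to (cvg_sqr_rnorm xs) hh _; apply: nearW => n /=.
  by rewrite ltW//; have [] := sP n.
have lb (a : R) : rnorm o ^+ 2 <= rnorm (o - a%:C *: y) ^+ 2.
  apply: le_trans oE _.
  have xs' : (fun n => x - s n - a%:C *: y) @ \oo --> o - a%:C *: y.
    by apply: cvgB => //; exact: cvg_cst.
  apply: ler_cvg_to (cvg_cst _) (cvg_sqr_rnorm xs') _; apply: nearW => n /=.
  rewrite -addrA -opprD; apply: infE; apply: lsubspaceD => //.
  exact: lsubspaceZ.
clearbody o.
suff : rdot o y *+ 2 = 0 by move/eqP; rewrite mulrn_eq0 => /eqP.
apply: (linear_coef_eq0 (rdot_ge0 y)) => a.
by have := lb (- a); rewrite !rnormK !rdotE (rdotC y o); lra.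
Qed.

Lemma projection x : closed (S : set X) -> exists p, S p /\ orth S (x - p).
Proof.
move=> cS; have [s [p [Ss sp xp]]] := projection_seq x.
by exists p; split=> //; exact: closed_seq cS Ss sp.
Qed.

(** The approximating sequence of [projection_seq] converges to the vector itself
    when its limit leaves no orthogonal remainder. *)
Lemma orth0_dense : (forall y, orth S y -> y = 0) ->
  forall x (e : R), 0 < e -> exists s, S s /\ rnorm (x - s) < e.
Proof.
move=> S0 x e e0; have [s [p [Ss sp /S0/eqP]]] := projection_seq x.
rewrite subr_eq0 => /eqP xp; have [N NP] := (cvg_seq_lt s p).1 sp e e0.
by exists (s N); split=> //; rewrite rnormBC xp; exact: NP.
Qed.

End Projection.

(** * Adjoints, uniform boundedness and compactness in sequences *)

Section BoundedOperators.
Context (R : realType) (X Y : preHilbertType R) (f : bop X Y).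

Lemma bop_rnorm : exists2 M : R, 0 <= M & forall x, rnorm (f x) <= M * rnorm x.
Proof.
have [M fM] := bop_bounded f; exists `|M| => // x.
have := fM x; rewrite !normE -rmorphM/= lecR => /le_trans; apply.
by rewrite ler_wpM2r ?rnorm_ge0// ler_norm.
Qed.

Lemma cvg_bop {T : Type} {F : set_system T} {FF : Filter F} (g : T -> X) x :
  g @ F --> x -> (fun t => f (g t)) @ F --> (f x : Y).
Proof.
have [M M0 fM] := bop_rnorm.
rewrite !cvg_rnormP => gx.
apply: (squeeze_cvgr _ (cvg_cst 0)
  (_ : (fun t => M * rnorm (g t - x)) @ F --> 0)).
  by apply: nearW => t; rewrite rnorm_ge0 -linearB fM.
by rewrite -[X in _ --> X](mulr0 M); apply: cvgM gx; exact: cvg_cst.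
Qed.

End BoundedOperators.

Lemma bop_of (R : realType) (X Y : preHilbertType R) (f : X -> Y) (M : R) :
  (forall (a : R[i]) x y, f (a *: x + y) = a *: f x + f y) ->
  (forall x, rnorm (f x) <= M * rnorm x) ->
  exists g : bop X Y, forall x, g x = f x.
Proof.
move=> lf bf.
pose F : {linear X -> Y} := HB.pack f (GRing.isLinear.Build _ _ _ _ _ lf).
have bF : exists M : R, forall x, `|F x| <= M%:C * `|x|.
  by exists M => x; rewrite !normE -rmorphM/= lecR; exact: bf.
by exists (Bop bF).
Qed.

Section Riesz.
Context (R : realType) (X : preHilbertType R).

(** Riesz representation: the kernel of the functional is a closed subspace, and
    a vector orthogonal to it represents the functional up to a factor. *)
Lemma riesz (f : X -> R[i]) (M : R) : seq_complete X ->
  (forall (a : R[i]) x y, f (a *: x + y) = a * f x + f y) ->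
  (forall x, `|f x| <= (M * rnorm x)%:C) ->
  exists y, forall x, f x = inner x y.
Proof.
move=> cX lf bf.
have f0 : f 0 = 0.
  have := lf 1 0 0; rewrite scale1r mul1r addr0 => /eqP.
  by rewrite addrC -subr_eq subrr eq_sym => /eqP.
have fP a x y : f x = 0 -> f y = 0 -> f (a *: x + y) = 0.
  by move=> fx fy; rewrite lf fx fy mulr0 addr0.
pose K := @LSubspace _ _ [set x | f x = 0] f0 fP.
have cK : closed (K : set X).
  apply: seq_closed => u x Ku ux; rewrite /=.
  have fux n : `|f x| <= (`|M| * rnorm (u n - x))%:C.
    have -> : f x = f (-1 *: u n + x).
      by rewrite lf (Ku n) mulr0 add0r.
    apply: le_trans (bf _) _; rewrite scaleN1r addrC rnormBC lecR.
    by rewrite ler_wpM2r ?rnorm_ge0// ler_norm.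
  apply: normr0_eq0; rewrite normc_def; congr (_%:C).
  have fle n : Num.sqrt (complex.Re (f x) ^+ 2 + complex.Im (f x) ^+ 2)
      <= `|M| * rnorm (u n - x).
    by rewrite -lecR -normc_def.
  apply/eqP; rewrite eq_le sqrtr_ge0 andbT.
  have lim : (fun n => `|M| * rnorm (u n - x)) @ \oo --> 0.
    rewrite -[X in _ --> X](mulr0 `|M|); apply: cvgM; first exact: cvg_cst.
    exact/cvg_rnormP.
  by apply: ler_cvg_to (cvg_cst _) lim _; exact: nearW.
have [[x0 fx0]|nx] := pselect (exists x, f x <> 0); last first.
  by exists 0 => x; rewrite linear0r; apply: contrapT => fx; apply: nx; exists x.
have [p [Kp po]] := projection cX x0 cK.
set o := x0 - p in po.
have fo : f o = f x0.
  by rewrite /o addrC -scaleN1r lf Kp mulr0 add0r.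
have fo0 : f o != 0 by rewrite fo; apply/eqP.
have o0 : inner o o != 0.
  apply: contra fo0; rewrite -sqr_norm_inner sqrf_eq0 normr_eq0 => /eqP ->.
  by rewrite f0.
exists (Num.conj (f o / inner o o) *: o) => x.
have Kx : K (x - (f x / f o) *: o).
  by rewrite /K/= addrC -scaleNr lf mulNr divfK// addNr.
have : inner (x - (f x / f o) *: o) o = 0 by rewrite dotJ (po _ Kx) rmorph0.
rewrite linearBl/= linearZl_LR/= => /eqP; rewrite subr_eq0 => /eqP xo.
rewrite linearZr_LR/= conjCK xo; field.
by rewrite o0 fo0.
Qed.

End Riesz.

(** The adjoint is defined everywhere, by the Riesz representation of
    [fun u => inner (f u) y]. *)
Lemma bop_adjoint (R : realType) (X Y : preHilbertType R) (f : bop X Y) y :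
  seq_complete X -> exists x, adjoint (graph f) (y, x).
Proof.
move=> cX; have [M M0 fM] := bop_rnorm f.
have [||x xP] := @riesz R X (fun u => inner (f u) y) (M * rnorm y) cX.
- by move=> a u v; rewrite linearP linearPl.
- move=> u; have := dot_cauchy_schwarz (@inner R Y) (f u) y.
  rewrite /dot_norm -!sqr_norm_inner !sqrCK// !normE -rmorphM/= => /le_trans; apply.
  by rewrite lecR mulrAC ler_wpM2r ?rnorm_ge0.
by exists x => u v /= ->.
Qed.

(** The component of the pair orthogonal to the closed graph belongs, after
    rotation, to the adjoint. The hypothesis thus makes the pair orthogonal to
    this component, which is therefore zero. *)
Lemma biadjoint (R : realType) (X Y : preHilbertType R) (A : linrel X Y) a c :
  seq_complete X -> seq_complete Y -> closed (A : set (hprod X Y)) ->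
  (forall y x, adjoint A (y, x) -> rdot x a = rdot y c) -> A (a, c).
Proof.
move=> cX cY cA Aac; pose ac : hprod X Y := (a, c).
have [p [Ap /orth_rdot po]] := projection (hprod_complete cX cY) ac cA.
set o := ac - p in po.
have rdotp (w z : hprod X Y) : rdot w z = rdot w.1 z.1 + rdot w.2 z.2.
  by rewrite /rdot -raddfD.
have Ao : adjoint A (o.2, - o.1).
  move=> u v Auv /=; have := (orth_rdot A o).2 po (u, v) Auv.
  rewrite dotJ /inner/= /hprod_dot/= => /(congr1 Num.conj).
  rewrite conjCK rmorph0 => /eqP; rewrite addrC addr_eq0 => /eqP ->.
  by rewrite linearNr.
have := Aac _ _ Ao; rewrite rdotNl => oac.
have o0 : o = 0.
  apply: rdot_eq0; rewrite {2}/o rdotDr rdotNr (po p Ap) subr0 rdotp/=.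
  lra.
by move: Ap; rewrite (_ : p = ac)//; apply/esym/eqP; rewrite -subr_eq0; apply/eqP.
Qed.

(** Uniform boundedness for inner products, by a gliding hump: if the norms grow
    like [4 ^ n] along a subsequence, the signs in a series of vectors of norms
    [3 ^- n] can be chosen so that no inner product with the sum is small. *)
Lemma weakly_bounded (R : realType) (X : preHilbertType R) (xi : nat -> X) :
  seq_complete X -> (forall w, exists B, forall n, rdot w (xi n) <= B) ->
  exists B : R, forall n, rnorm (xi n) <= B.
Proof.
move=> cX wb; apply: contrapT => nb.
have /choice[k kP] (n : nat) : exists k, 4 ^+ n < rnorm (xi k).
  apply: contrapT => nk; apply: nb; exists (4 ^+ n) => m.
  by rewrite leNgt; apply/negP => ?; apply: nk; exists m.
pose z n := xi (k n).
have z0 n : 0 < rnorm (z n) by apply: lt_trans (kP n); rewrite exprn_gt0.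
pose e n := (rnorm (z n))^-1%:C *: z n.
have e1 n : rnorm (e n) = 1.
  by rewrite rnormZ ger0_norm ?invr_ge0 ?rnorm_ge0// mulVf// gt_eqF.
(* The tail of the series after the [n]-th term is at most half of that term. *)
pose r n : R := 3^-1 ^+ n.
have r0 n : 0 < r n by rewrite exprn_gt0.
pose s (w : X) n : R := if 0 <= rdot w (z n) then 1 else -1.
pose w := fix w n := if n is m.+1 then w m + (s (w m) m * r m)%:C *: e m else 0.
have wS n : w n.+1 = w n + (s (w n) n * r n)%:C *: e n by [].
have s1 v n : `|s v n| = 1 by rewrite /s; case: ifP; rewrite ?normrN normr1.
have big n : r n * rnorm (z n) <= `|rdot (w n.+1) (z n)|.
  rewrite wS rdotDl rdotZl /e rdotZl -rnormK /s; case: ifPn => [h|].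
    rewrite ger0_norm.
      rewrite expr2 mul1r mulKf ?gt_eqF//; lra.
    by rewrite addr_ge0// !mulr_ge0// ?invr_ge0 ?rnorm_ge0// ?ltW.
  rewrite -ltNge => h; rewrite expr2 mulKf ?gt_eqF// mulN1r mulNr ltr0_norm.
    lra.
  by rewrite ltrBlDr add0r (lt_le_trans h)// mulr_ge0 ?ltW.
have step n : rnorm (w n.+1 - w n) <= r n.
  rewrite wS addrAC subrr add0r rnormZ e1 mulr1 normrM s1 mul1r.
  by rewrite ger0_norm// ltW.
have rS n : r n.+1 = 3^-1 * r n by rewrite /r exprS.
have far m n : (m <= n)%N -> rnorm (w n - w m) <= (3 / 2) * (r m - r n).
  move=> /subnK <-; elim: (n - m)%N => [|j IH].
    by rewrite !add0n !subrr rnorm0 mulr0.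
  rewrite addSn; have -> : w (j + m).+1 - w m
      = (w (j + m).+1 - w (j + m)) + (w (j + m) - w m).
    by vector_ring.
  apply: le_trans (rnormD _ _) _.
  have := step (j + m)%N; rewrite rS; lra.
have rcvg : r @ \oo --> (0 : R).
  by apply: cvg_expr; rewrite ger0_norm ?invr_ge0// invf_lt1// ltr1n.
have [v wv] : exists v : X, w @ \oo --> v.
  apply: cX; apply: (@seq_cauchy_rate _ _ _ (fun n => 3 / 2 * r n)).
    by rewrite -[X in _ --> X](mulr0 (3 / 2)); apply: cvgM rcvg; exact: cvg_cst.
  by move=> m n /far /le_trans; apply; have := ltW (r0 n); lra.
have vw n : rnorm (v - w n.+1) <= r n / 2.
  have lim : (fun j => w j - w n.+1) @ \oo --> v - w n.+1.
    by apply: cvgB => //; exact: cvg_cst.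
  apply: ler_cvg_to (cvg_rnorm lim) (cvg_cst _) _; exists n.+1 => // j /= nj.
  by apply: le_trans (far _ _ nj) _; rewrite rS; have := ltW (r0 j); lra.
have low n : 2^-1 * (4 / 3) ^+ n <= `|rdot v (z n)|.
  have -> : rdot v (z n) = rdot (w n.+1) (z n) - rdot (w n.+1 - v) (z n).
    by rewrite !rdotE; ring.
  apply: le_trans (lerB_dist _ _).
  have := rdot_norm (w n.+1 - v) (z n); rewrite rnormBC => h.
  have := ler_wpM2r (rnorm_ge0 (z n)) (vw n).
  have := big n; have := ltW (kP n); rewrite -/(z n) => /(ler_wpM2l (ltW (r0 n))).
  rewrite {1}/r -exprMn (_ : 3^-1 * 4 = 4 / 3 :> R); last by rewrite mulrC.
  lra.
have [B1 vB1] := wb v; have [B2 vB2] := wb (- v).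
have vB n : `|rdot v (z n)| <= Num.max B1 B2.
  by rewrite ler_norml lerNl -rdotNl !le_max vB1 vB2 orbT.
have up n : (4 / 3) ^+ n <= 2 * Num.max B1 B2 :> R.
  by have := le_trans (low n) (vB n); lra.
have bern n : 1 + n%:R / 3 <= (4 / 3) ^+ n :> R.
  elim: n => [|n IH]; first by rewrite mul0r addr0.
  by rewrite exprS -natr1; have : 0 <= n%:R :> R by []; nra.
have [N NP] : exists N : nat, 6 * Num.max B1 B2 < N%:R.
  by exists (Num.truncn (6 * Num.max B1 B2)).+1; rewrite truncnS_gt.
by have := up N; have := bern N; lra.
Qed.

Section Compactness.
Context (R : realType) (X : preHilbertType R).

Definition has_cvg_subseq (u : nat -> X) := exists (k : nat -> nat) (x : X),
  (forall n, (n <= k n)%N) /\ (u \o k) @ \oo --> x.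

Lemma precompact_subseq (S : set X) (u : nat -> X) :
  precompact S -> (forall n, S (u n)) -> has_cvg_subseq u.
Proof.
rewrite precompactE => cS Su.
have [|x [_ ux]] := cS (u @ \oo) _.
  by exists 0%N => // n _; exact: subset_closure.
have /choice[k kP] (n : nat) :
    exists m, (n <= m)%N /\ rnorm (u m - x) < n.+1%:R^-1.
  have n0 : 0 < (n.+1%:R^-1 : R)%:C by rewrite ltcR invr_gt0.
  have [|y [[m /= nm <-]]] := ux (u @` [set m | (n <= m)%N]) _ _ (nbhsx_ballx x _ n0).
    by exists n => // m /= nm; exists m.
  by rewrite -ball_normE/= normE ltcR rnormBC => yx; exists m.
exists k, x; split=> [n|]; first by have [] := kP n.
apply: (cvg_seq_squeeze (@cvg_harmonic R)) => n.
by apply: ltW; have [] := kP n.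
Qed.

End Compactness.

Lemma compactly_embedded_subseq (R : realType) (X Y : preHilbertType R)
    (A : linrel X Y) (S : lsubspace X) (B : R) (u : nat -> X) (v : nat -> Y) :
  compactly_embedded A S -> (forall n, S (u n)) -> (forall n, A (u n, v n)) ->
  (forall n, rnorm (u n) <= B) -> (forall n, rnorm (v n) <= B) ->
  has_cvg_subseq u.
Proof.
move=> cA Su Auv uB vB.
have B0 : 0 <= B by apply: le_trans (uB 0); exact: rnorm_ge0.
pose b := (2 * B + 1)^-1.
have b0 : 0 < b by rewrite invr_gt0; lra.
have bB : b * (2 * B + 1) = 1 by rewrite mulVf// gt_eqF//; lra.
have [|k [x [kn ux]]] := @precompact_subseq _ _ _ (fun n => b%:C *: u n) cA.
  move=> n; split; first exact: (lsubspaceZ (S := S)).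
  exists (b%:C *: v n).
    have := lsubspaceZ (S := A) b%:C (Auv n); exact.
  rewrite normE lecR.
  have [_ _ /le_trans] := rnorm_hprod_le ((b%:C *: u n, b%:C *: v n) : hprod X Y).
  apply; rewrite !rnormZ gtr0_norm//.
  by have := uB n; have := vB n; nra.
exists k, (b^-1%:C *: x); split=> //.
have : (fun n => b^-1%:C *: (b%:C *: u (k n))) @ \oo --> b^-1%:C *: x.
  exact: cvgZl_tmp.
rewrite (_ : (fun n => _) = u \o k)//; apply/funext => n /=.
by rewrite scalerA -rmorphM/= mulVf ?gt_eqF// scale1r.
Qed.

(** * Contraction semigroups from maximal dissipative operators *)

Section LinearRelation.
Context (R : realType) (X Y : preHilbertType R) (A : linrel X Y).

Lemma linrelD x y x' y' : A (x, y) -> A (x', y') -> A (x + x', y + y').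
Proof. by move=> h h'; have := lsubspaceD (S := A) h h'; exact. Qed.

Lemma linrelB x y x' y' : A (x, y) -> A (x', y') -> A (x - x', y - y').
Proof. by move=> h h'; have := lsubspaceB (S := A) h h'; exact. Qed.

Lemma linrelZ (a : R[i]) x y : A (x, y) -> A (a *: x, a *: y).
Proof. by move=> h; have := lsubspaceZ (S := A) a h; exact. Qed.

End LinearRelation.

Definition dissipative (R : realType) (X : preHilbertType R) (A : linrel X X) :=
  forall x y, A (x, y) -> rdot y x <= 0.

Definition contraction_semigroup (R : realType) (X : preHilbertType R)
    (T : R -> bop X X) :=
  C0_semigroup T /\ forall t : R, 0 <= t -> forall x, rnorm (T t x) <= rnorm x.

Lemma generator_dissipative (R : realType) (X : preHilbertType R)
  (T : R -> bop X X) : contraction_semigroup T -> dissipative (generator T).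
Proof.
move=> [_ T_le] x y /= Txy.
apply: ler_cvg_to (cvg_rdot (z := x) Txy) (cvg_cst 0) _.
near=> t; have t0 : 0 < t by near: t; exact: nbhs_right_gt.
rewrite rdotZl rdotDl rdotNl -rnormK pmulr_rle0 ?invr_gt0// subr_le0.
apply: le_trans (rdot_le _ _) _.
by rewrite expr2 ler_wpM2r ?rnorm_ge0// T_le// ltW.
Unshelve. all: by end_near. Qed.

Section Generation.
Context (R : realType) (X : preHilbertType R) (A : linrel X X).
Hypothesis cX : seq_complete X.
Hypothesis A_single : single_valued A.
Hypothesis A_dissip : dissipative A.
Hypothesis A_max :
  forall h : R, 0 < h -> forall f, exists x y, A (x, y) /\ x - h%:C *: y = f.

(** [<x - h y, x - h y>] equals [<x, x>] plus the nonnegative terms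
    [- 2 h <y, x>] and [h ^+ 2 <y, y>], so the resolvent is a contraction. *)
Lemma dissip_expand (h : R) x y :
  0 <= h -> A (x, y) -> rnorm x <= rnorm (x - h%:C *: y).
Proof.
move=> h0 /A_dissip yx; rewrite ler_rnorm !rdotE (rdotC x y).
by have := mulr_ge0 h0 (mulr_ge0 h0 (rdot_ge0 y)); nra.
Qed.

Lemma resolvent_inj (h : R) x y x' y' : 0 <= h -> A (x, y) -> A (x', y') ->
  x - h%:C *: y = x' - h%:C *: y' -> x = x'.
Proof.
move=> h0 Ax Ax' xx'; apply/eqP; rewrite -subr_eq0; apply/eqP/rnorm0_eq0.
apply/eqP; rewrite eq_le rnorm_ge0 andbT.
apply: le_trans (dissip_expand h0 (linrelB Ax Ax')) _.
rewrite (_ : _ - _ = 0) ?rnorm0//.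
have -> : x - x' - h%:C *: (y - y') = x - h%:C *: y - (x' - h%:C *: y').
  by vector_ring.
by rewrite xx' subrr.
Qed.

(** The last clause determines [J] as the inverse of [1 - h A]. *)
Definition is_resolvent (h : R) (J : bop X X) := forall f,
  [/\ A (J f, h^-1%:C *: (J f - f)), rnorm (J f) <= rnorm f &
      forall x y, A (x, y) -> x - h%:C *: y = f -> x = J f].

Lemma resolvent_ex (h : R) : 0 < h -> exists J, is_resolvent h J.
Proof.
move=> h0; have /choice[j jP] f :
    exists x, exists y, A (x, y) /\ x - h%:C *: y = f := A_max h0 f.
have uni f x y : A (x, y) -> x - h%:C *: y = f -> x = j f.
  move=> Ay xE; have [y' [Ay' fE]] := jP f.
  by apply: resolvent_inj (ltW h0) Ay Ay' _; rewrite fE.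
have jn f : rnorm (j f) <= 1 * rnorm f.
  by have [y [Ay {2}<-]] := jP f; rewrite mul1r; apply: dissip_expand => //; exact: ltW.
have [|J JE] := bop_of _ jn.
  move=> a f g; have [y [Ay fE]] := jP f; have [y' [Ay' gE]] := jP g.
  apply/esym; apply: uni (linrelD (linrelZ a Ay) Ay') _.
  rewrite -{2}fE -{2}gE scalerBr scalerDr !scalerA [h%:C * a]mulrC.
  by rewrite opprD addrACA.
exists J => f; rewrite JE; split; last exact: uni.
  have [y [Ay fE]] := jP f.
  rewrite (_ : _ *: _ = y)// -{2}fE opprB addrC subrK scalerA -rmorphM/=.
  by rewrite mulVf ?gt_eqF// scale1r.
by rewrite -[X in _ <= X]mul1r.
Qed.

Lemma resolvents_ex :
  exists J : R -> bop X X, forall h : R, 0 < h -> is_resolvent h (J h).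
Proof.
have [J1 _] := resolvent_ex (ltr01 : 0 < (1 : R)).
have /choice[J JP] (h : R) : exists J, 0 < h -> is_resolvent h J.
  have [h0|h0] := boolP (0 < h); last by exists J1.
  by have [J JP] := resolvent_ex h0; exists J.
by exists J.
Qed.

Section ImplicitEuler.
Variable J : R -> bop X X.
Hypothesis JP : forall h : R, 0 < h -> is_resolvent h (J h).

Lemma euler_le (h : R) n x : 0 < h -> rnorm (iter n (J h) x) <= rnorm x.
Proof.
move=> h0; elim: n => //= n IH; apply: le_trans IH.
by have [] := JP h0 (iter n (J h) x).
Qed.

Lemma eulerB (h : R) n x y :
  iter n (J h) (x - y) = iter n (J h) x - iter n (J h) y.
Proof. by elim: n => //= n ->; rewrite linearB. Qed.

(** Both sides solve the same resolvent equation; this says that [A] commutes with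
    its resolvent. *)
Lemma resolventE (h : R) x y : 0 < h -> A (x, y) -> J h x - x = h%:C *: J h y.
Proof.
move=> h0 Ay; have [AJ _ _] := JP h0 x; have [_ _ uni] := JP h0 y.
have h1 : h * h^-1 = 1 by rewrite mulfV// gt_eqF.
have <- : h^-1%:C *: (J h x - x) = J h y.
  apply: (uni _ _ (linrelZ (h^-1%:C) (linrelB AJ Ay))).
  by rewrite scalerA -rmorphM/= h1 scale1r opprB addrC subrK.
by rewrite scalerA -rmorphM/= h1 scale1r.
Qed.

Lemma resolvent_rel (h : R) x y : 0 < h -> A (x, y) -> A (J h x, J h y).
Proof.
move=> h0 Ay; have [AJ _ _] := JP h0 x; rewrite (resolventE h0 Ay) in AJ.
by move: AJ; rewrite scalerA -rmorphM/= mulVf ?gt_eqF// scale1r.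
Qed.

Lemma euler_rel (h : R) n x y :
  0 < h -> A (x, y) -> A (iter n (J h) x, iter n (J h) y).
Proof. by move=> h0 Ay; elim: n => //= n; exact: resolvent_rel. Qed.

Lemma euler_dist (h : R) n x y :
  0 < h -> A (x, y) -> rnorm (iter n (J h) x - x) <= n%:R * h * rnorm y.
Proof.
move=> h0 Ay; elim: n => [|n IH]; first by rewrite subrr rnorm0 !mul0r.
have -> : iter n.+1 (J h) x - x
    = (J h (iter n (J h) x) - iter n (J h) x) + (iter n (J h) x - x).
  by rewrite addrA subrK.
rewrite (resolventE h0 (euler_rel n h0 Ay)); apply: le_trans (rnormD _ _) _.
rewrite rnormZ gtr0_norm// -iterS -natr1 mulrDl mul1r mulrDl addrC.
by rewrite lerD// ler_wpM2l ?euler_le// ltW.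
Qed.

(** Halving the step changes the result by [(h / 2) ^+ 2] times contractions
    applied to [A ^+ 2 x], because [(1 - h / 2 A) ^+ 2 = (1 - h A) + (h / 2 A) ^+ 2]. *)
Lemma euler_halve1 (h : R) x y z : 0 < h -> A (x, y) -> A (y, z) ->
  rnorm (J h x - J (h / 2) (J (h / 2) x)) <= (h / 2) ^+ 2 * rnorm z.
Proof.
move=> h0 Ay Az; set k := h / 2; have k0 : 0 < k by rewrite divr_gt0.
set p1 := J k x; set p := J k p1.
have Ay1 := resolvent_rel k0 Ay; have Az1 := resolvent_rel k0 Az.
have e1 := resolventE k0 Ay; have e2 := resolventE k0 Ay1.
have e3 := resolventE k0 Az1; have e4 := resolventE k0 Az.
rewrite -/p1 in Ay1 e1 e2; rewrite -/p in e2.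
set y1 := J k y in Ay1 e1 e2 e3 e4 Az1 *; set y2 := J k y1 in e2 e3.
set z1 := J k z in Az1 e3 e4 *; set z2 := J k z1 in e3.
have -> : p = J h (x - (k ^+ 2)%:C *: z2).
  have [_ _ uni] := JP h0 (x - (k ^+ 2)%:C *: z2).
  apply: uni (resolvent_rel k0 Ay1) _; rewrite -/y2 -/p.
  have -> : p = p1 + k%:C *: y2 by rewrite -e2 addrC subrK.
  have -> : y2 = y1 + k%:C *: z2 by rewrite -e3 addrC subrK.
  have -> : p1 = x + k%:C *: y1 by rewrite -e1 addrC subrK.
  have -> : h = 2 * k by rewrite /k mulrC divfK.
  by vector_ring.
rewrite -linearB opprB addrC subrK.
have [_ + _] := JP h0 ((k ^+ 2)%:C *: z2) => /le_trans; apply.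
rewrite rnormZ ger0_norm ?sqr_ge0// ler_wpM2l ?sqr_ge0//.
exact: (euler_le 2 z k0).
Qed.

Lemma euler_halve (h : R) n x y z : 0 < h -> A (x, y) -> A (y, z) ->
  rnorm (iter n (J h) x - iter n.*2 (J (h / 2)) x)
  <= n%:R * (h / 2) ^+ 2 * rnorm z.
Proof.
move=> h0 Ay Az; set k := h / 2; have k0 : 0 < k by rewrite divr_gt0.
elim: n => [|n IH]; first by rewrite subrr rnorm0 !mul0r.
rewrite doubleS !iterS; set a := iter n (J h) x in IH *.
set b := iter n.*2 (J k) x in IH *.
have -> : J h a - J k (J k b) = J h (a - b) + (J h b - J k (J k b)).
  by rewrite linearB addrA subrK.
apply: le_trans (rnormD _ _) _; rewrite -natr1 mulrDl mul1r mulrDl lerD//.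
  by have [_ + _] := JP h0 (a - b) => /le_trans; apply.
apply: le_trans (euler_halve1 h0 (euler_rel n.*2 k0 Ay) (euler_rel n.*2 k0 Az)) _.
by rewrite ler_wpM2l ?sqr_ge0// euler_le.
Qed.

(** The remainder is a sum of [n] terms [h *: (J ^+ j y - y)]. As [y] need not lie
    in the domain, each is estimated through a nearby vector [w] that does. *)
Lemma euler_taylor (h : R) n x y w v : 0 < h -> A (x, y) -> A (w, v) ->
  rnorm (iter n (J h) x - x - (n%:R * h)%:C *: y)
  <= n%:R * h * (2 * rnorm (y - w) + n%:R * h * rnorm v).
Proof.
move=> h0 Ay Av; elim: n => [|n IH].
  by rewrite subrr !mul0r scale0r subr0 rnorm0.
rewrite iterS; set a := iter n (J h) x in IH *.
have Aa := euler_rel n h0 Ay; rewrite -/a in Aa.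
have -> : J h a - x - (n.+1%:R * h)%:C *: y
    = (a - x - (n%:R * h)%:C *: y) + (J h a - a - h%:C *: y).
  by apply: rdot_ext => q; rewrite !rdotE -natr1; ring.
rewrite (resolventE h0 Aa) -scalerBr -iterS; set b := iter n.+1 (J h) y.
apply: le_trans (rnormD _ _) _; rewrite rnormZ (gtr0_norm h0).
have bB : rnorm (b - y) <= 2 * rnorm (y - w) + n.+1%:R * h * rnorm v.
  have -> : b - y = iter n.+1 (J h) (y - w) + (iter n.+1 (J h) w - w) + (w - y).
    by rewrite eulerB -/b; vector_ring.
  have := rnormD (iter n.+1 (J h) (y - w) + (iter n.+1 (J h) w - w)) (w - y).
  have := rnormD (iter n.+1 (J h) (y - w)) (iter n.+1 (J h) w - w).
  have := euler_dist n.+1 h0 Av; have := euler_le n.+1 (y - w) h0.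
  rewrite (rnormBC w y); lra.
have := ler_wpM2l (ltW h0) bB; rewrite -natr1.
have := mulr_ge0 (mulr_ge0 (ler0n R n) (ltW h0)) (mulr_ge0 (ltW h0) (rnorm_ge0 v)).
move: IH; nra.
Qed.

Definition step k : R := 2^-1 ^+ k.

Lemma step_gt0 k : 0 < step k. Proof. by rewrite exprn_gt0. Qed.

Lemma stepS k : step k.+1 = step k / 2.
Proof. by rewrite /step exprSr. Qed.

Lemma cvg_step (c : R) : (fun k => step k * c) @ \oo --> 0.
Proof.
rewrite -[X in _ --> X](mul0r c); apply: cvgM; last exact: cvg_cst.
by apply: cvg_expr; rewrite ger0_norm ?invr_ge0// invf_lt1// ltr1n.
Qed.

Definition nsteps k (t : R) := Num.truncn (t / step k).

Lemma nstepsP k (t : R) n : 0 <= t ->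
  (nsteps k t == n) = (n%:R * step k <= t < n%:R * step k + step k).
Proof.
move=> t0; rewrite truncn_eq; last by rewrite divr_ge0// ltW// step_gt0.
rewrite ler_pdivlMr ?step_gt0// ltr_pdivrMr ?step_gt0// -natr1.
by rewrite mulrDl mul1r.
Qed.

Lemma nsteps_itv k (t : R) : 0 <= t ->
  (nsteps k t)%:R * step k <= t < (nsteps k t)%:R * step k + step k.
Proof. by move=> t0; rewrite -nstepsP. Qed.

(** Refining the grid doubles the number of steps up to one; this extra step costs
    [O(step k)] on the domain, as does the one in [nstepsD]. *)
Lemma nstepsS k (t : R) : 0 <= t ->
  exists b : bool, nsteps k.+1 t = (b + (nsteps k t).*2)%N.
Proof.
move=> t0; have := nsteps_itv k t0; set n := nsteps k t => nt.
have h0 := step_gt0 k.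
exists ((n%:R * step k + step k / 2) <= t); apply/eqP; rewrite nstepsP//.
rewrite stepS natrD -muln2 natrM.
by case: (lerP (n%:R * step k + step k / 2) t) => ht /=; lra.
Qed.

Lemma nstepsD k (s t : R) : 0 <= s -> 0 <= t ->
  exists b : bool, nsteps k (s + t) = (b + (nsteps k s + nsteps k t))%N.
Proof.
move=> s0 t0; have := nsteps_itv k s0; have := nsteps_itv k t0.
set n := nsteps k t; set m := nsteps k s => nt ms.
have h0 := step_gt0 k.
exists ((m%:R + n%:R + 1) * step k <= s + t); apply/eqP.
rewrite nstepsP ?addr_ge0// !natrD.
by case: (lerP ((m%:R + n%:R + 1) * step k) (s + t)) => ht /=; lra.
Qed.

Definition euler k t x := iter (nsteps k t) (J (step k)) x.

Lemma euler_bool (h : R) (b : bool) x y : 0 < h -> A (x, y) ->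
  rnorm (iter b (J h) x - x) <= h * rnorm y.
Proof.
move=> h0 Ay; apply: le_trans (euler_dist b h0 Ay) _.
rewrite ler_wpM2r ?rnorm_ge0//; case: b; rewrite ?mul1r ?mul0r//.
exact: ltW.
Qed.

Lemma euler_step k (t : R) x y z : 0 <= t -> A (x, y) -> A (y, z) ->
  rnorm (euler k.+1 t x - euler k t x) <= step k * (t * rnorm z + rnorm y).
Proof.
move=> t0 Ay Az; have h0 := step_gt0 k; have h1 := step_gt0 k.+1.
rewrite /euler; have [b ->] := nstepsS k t0; have := nsteps_itv k t0.
set n := nsteps k t => nt; rewrite iterD; set a := iter n.*2 _ x.
have -> : iter b (J (step k.+1)) a - iter n (J (step k)) x
    = (iter b (J (step k.+1)) a - a) + (a - iter n (J (step k)) x).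
  by rewrite addrA subrK.
apply: le_trans (rnormD _ _) _; rewrite (rnormBC a).
have := euler_bool b h1 (euler_rel n.*2 h1 Ay).
have := euler_halve n h0 Ay Az; rewrite -stepS -/a => ha hb.
have := ler_wpM2l (ltW h1) (euler_le n.*2 y h1) => hc.
have hd : n%:R * step k.+1 ^+ 2 * rnorm z <= t * step k * rnorm z.
  rewrite ler_wpM2r ?rnorm_ge0// stepS.
  have : n%:R * step k * step k <= t * step k by rewrite ler_pM2r//; lra.
  have := mulr_ge0 (mulr_ge0 (ler0n R n) (ltW h0)) (ltW h0); lra.
have he : step k.+1 * rnorm y <= step k * rnorm y.
  by rewrite ler_wpM2r ?rnorm_ge0// stepS; lra.
lra.
Qed.

Lemma euler_cauchy m n (t : R) x y z : 0 <= t -> A (x, y) -> A (y, z) -> (m <= n)%N ->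
  rnorm (euler n t x - euler m t x)
  <= 2 * (step m - step n) * (t * rnorm z + rnorm y).
Proof.
move=> t0 Ay Az /subnK <-; elim: (n - m)%N => [|j IH].
  by rewrite add0n !subrr rnorm0 mulr0 mul0r.
rewrite addSn; set e := euler _ _ _; set e' := euler m t x.
have -> : e - e' = (e - euler (j + m) t x) + (euler (j + m) t x - e').
  by rewrite addrA subrK.
apply: le_trans (rnormD _ _) _; apply: le_trans (lerD (euler_step _ t0 Ay Az) IH) _.
by rewrite stepS; lra.
Qed.

(** A vector orthogonal to the domain equals [u - A u] for some [u] in the domain;
    pairing it with [u] gives [<u, u> <= 0]. *)
Lemma dom_dense x (e : R) : 0 < e ->
  exists x' y, A (x', y) /\ rnorm (x - x') < e.
Proof.
move=> e0; have [|x' [[y Ay] xx']] := orth0_dense (S := dom A) cX _ x e0.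
  move=> w /orth_rdot wA; have [u [v [Av uv]]] := A_max ltr01 w.
  have wu : rdot w u = 0 by apply: wA; exists v.
  rewrite scale1r in uv.
  have u0 : u = 0.
    apply: rdot_eq0; apply/eqP; rewrite eq_le rdot_ge0 andbT.
    by have := A_dissip Av; rewrite -uv rdotDl rdotNl in wu; lra.
  by rewrite -uv u0 sub0r (A_single Av (_ : A (u, 0))) ?oppr0// u0; exact: lsubspace0.
by exists x', y.
Qed.

(** The resolvent maps the domain of [A] into that of [A ^+ 2] and tends to the
    identity as the step tends to zero. *)
Lemma dom2_dense x (e : R) : 0 < e ->
  exists x' y z, [/\ A (x', y), A (y, z) & rnorm (x - x') < e].
Proof.
move=> e0; have e2 : 0 < e / 2 by rewrite divr_gt0.
have [w [v [Av xw]]] := dom_dense x e2.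
pose h := e / (2 * (rnorm v + 1)).
have v0 := rnorm_ge0 v.
have h0 : 0 < h by rewrite divr_gt0// mulr_gt0// ltr_wpDl.
exists (J h w), (J h v), (h^-1%:C *: (J h v - v)); split.
- exact: resolvent_rel.
- by have [] := JP h0 v.
- have -> : x - J h w = (x - w) + (w - J h w) by rewrite addrA subrK.
  apply: le_lt_trans (rnormD _ _) _; rewrite (rnormBC w).
  have := euler_dist 1 h0 Av; rewrite mul1r /= => hw.
  have : h * (rnorm v + 1) = e / 2 by rewrite /h; field; lra.
  have := mulr_ge0 (ltW h0) v0; lra.
Qed.

Lemma euler_cvg (t : R) x : 0 <= t -> exists l : X, (fun k => euler k t x) @ \oo --> l.
Proof.
move=> t0; apply: cX => e e0; have e3 : 0 < e / 3 by lra.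
have [x' [y [z [Ay Az xx']]]] := dom2_dense x e3.
have [N NP] : exists N, forall m n, (N <= m)%N -> (N <= n)%N ->
    rnorm (euler m t x' - euler n t x') < e / 3.
  apply: (seq_cauchy_rate (cvg_step (2 * (t * rnorm z + rnorm y)))) e3 => m n mn.
  apply: le_trans (euler_cauchy t0 Ay Az mn) _.
  have := mulr_ge0 (ltW (step_gt0 n))
    (addr_ge0 (mulr_ge0 t0 (rnorm_ge0 z)) (rnorm_ge0 y)).
  lra.
exists N => m n Nm Nn; have := NP m n Nm Nn.
have -> : euler m t x - euler n t x = euler m t (x - x')
    + (euler m t x' - euler n t x') - euler n t (x - x').
  by rewrite /euler !eulerB; vector_ring.
set d := _ - _ => dm.
have := rnormD (euler m t (x - x') + d) (- euler n t (x - x')).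
have := rnormD (euler m t (x - x')) d; rewrite rnormN.
have := euler_le (nsteps m t) (x - x') (step_gt0 m).
have := euler_le (nsteps n t) (x - x') (step_gt0 n).
rewrite -/(euler _ _ _); lra.
Qed.

Lemma euler_limit : exists T : R -> bop X X, forall t : R, 0 <= t ->
  forall x, (fun k => euler k t x) @ \oo --> (T t x : X).
Proof.
have /choice[T TP] (t : R) : exists g : bop X X, 0 <= t ->
    forall x, (fun k => euler k t x) @ \oo --> (g x : X).
  have [t0|_] := boolP (0 <= t); last by exists (J 1).
  have /choice[g gP] x := euler_cvg x t0.
  have [| |G GE] := @bop_of _ _ _ g 1.
  - move=> a x y; apply: cvg_unique (gP (a *: x + y)) _ => //.
    rewrite (_ : (fun _ => _) = fun k => a *: euler k t x + euler k t y).
      by apply: cvgD => //; exact: cvgZl_tmp.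
    apply/funext => k; rewrite /euler.
    by elim: (nsteps k t) => //= n ->; rewrite linearP.
  - move=> x; rewrite mul1r; apply: ler_cvg_to (cvg_rnorm (gP x)) (cvg_cst _) _.
    by apply: nearW => k; exact: euler_le (step_gt0 k).
  by exists G => _ x; rewrite GE.
by exists T.
Qed.

Section Limit.
Variable T : R -> bop X X.
Hypothesis TP : forall t : R, 0 <= t ->
  forall x, (fun k => euler k t x) @ \oo --> (T t x : X).

Lemma limit_le (t : R) x : 0 <= t -> rnorm (T t x) <= rnorm x.
Proof.
move=> t0; apply: ler_cvg_to (cvg_rnorm (@TP t t0 x)) (cvg_cst _) _.
by apply: nearW => k; exact: euler_le (step_gt0 k).
Qed.

Lemma bop_dense_eq (f g : bop X X) :
  (forall x y, A (x, y) -> f x = g x) -> forall x, f x = g x.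
Proof.
move=> fg x.
have [M M0 fM] := bop_rnorm f; have [M' M'0 gM] := bop_rnorm g.
apply/eqP; rewrite -subr_eq0; apply/eqP/rnorm0_eq0/eqP.
rewrite eq_le rnorm_ge0 andbT; apply/ler_addgt0Pr => e e0; rewrite add0r.
have MM : 0 < M + M' + 1 by lra.
have [w [v [Av xw]]] := dom_dense x (divr_gt0 e0 MM).
have -> : f x - g x = f (x - w) - g (x - w).
  by rewrite !linearB (fg _ _ Av); vector_ring.
apply: le_trans (rnormD _ _) _; rewrite rnormN.
have := fM (x - w); have := gM (x - w).
move: xw; rewrite ltr_pdivlMr//; have := rnorm_ge0 (x - w); nra.
Qed.

Lemma limit_taylor (t : R) x y w v : 0 <= t -> A (x, y) -> A (w, v) ->
  rnorm (T t x - x - t%:C *: y) <= t * (2 * rnorm (y - w) + t * rnorm v).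
Proof.
move=> t0 Ay Av; set c := 2 * _ + _.
have lim : (fun k => euler k t x - x - t%:C *: y) @ \oo --> (T t x - x - t%:C *: y : X).
  by do 2! (apply: cvgB; last exact: cvg_cst); exact: TP.
have lim2 : (fun k => t * c + step k * rnorm y) @ \oo --> t * c.
  rewrite -[X in _ --> X]addr0; apply: cvgD; first exact: cvg_cst.
  exact: cvg_step.
apply: ler_cvg_to (cvg_rnorm lim) lim2 _; apply: nearW => k.
have h0 := step_gt0 k; have := nsteps_itv k t0.
have := euler_taylor (nsteps k t) h0 Ay Av.
rewrite -/(euler k t x); set s := _ * step k => ht st.
have -> : euler k t x - x - t%:C *: y = (euler k t x - x - s%:C *: y) - (t - s)%:C *: y.
  by vector_ring.
apply: le_trans (rnormD _ _) _; rewrite rnormN rnormZ.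
have s0 : 0 <= s by rewrite mulr_ge0// ltW.
apply: lerD.
  apply: le_trans ht _; apply: ler_pM => //; last 2 first.
  - lra.
  - by rewrite lerD2l ler_wpM2r ?rnorm_ge0//; lra.
  - by rewrite addr_ge0// mulr_ge0 ?rnorm_ge0.
by rewrite ler_wpM2r ?rnorm_ge0// ger0_norm; lra.
Qed.

Lemma limit_dist (t : R) x y : 0 <= t -> A (x, y) ->
  rnorm (T t x - x) <= t * rnorm y.
Proof.
move=> t0 Ay.
have lim : (fun k => euler k t x - x) @ \oo --> (T t x - x : X).
  by apply: cvgB; [exact: TP|exact: cvg_cst].
apply: ler_cvg_to (cvg_rnorm lim) (cvg_cst _) _; apply: nearW => k.
have h0 := step_gt0 k; have := nsteps_itv k t0.
have := euler_dist (nsteps k t) h0 Ay.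
rewrite -/(euler k t x) => /le_trans ht st; apply: ht.
by rewrite ler_wpM2r ?rnorm_ge0//; lra.
Qed.

Lemma limit0 x : T 0 x = x.
Proof.
apply: cvg_unique (@TP 0 (lexx 0) x) _ => //.
rewrite (_ : (fun _ => _) = fun=> x); first exact: cvg_cst.
by apply/funext => k; rewrite /euler /nsteps mul0r truncn0.
Qed.

Lemma limitD (s t : R) x : 0 <= s -> 0 <= t -> T (s + t) x = T s (T t x).
Proof.
move=> s0 t0.
have [M M0 sM] := bop_rnorm (T s); have [M' M'0 tM] := bop_rnorm (T t).
have [||st stE] := @bop_of _ _ _ (fun x => T s (T t x)) (M * M').
- by move=> a u v; rewrite !linearP.
- move=> u; apply: le_trans (sM _) _; rewrite -mulrA ler_wpM2l//.
rewrite -stE; apply: bop_dense_eq x => x y Ay; rewrite stE.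
have st0 := addr_ge0 s0 t0.
apply: (cvg_unique _ (@TP (s + t) st0 x)) => //.
have lim : (fun k => rnorm (euler k t x - T t x) +
    (rnorm (euler k s (T t x) - T s (T t x)) + step k * rnorm y)) @ \oo
    --> 0 + (0 + 0 : R).
  apply: cvgD; first exact/cvg_rnormP/TP.
  by apply: cvgD; [exact/cvg_rnormP/TP|exact: cvg_step].
rewrite !addr0 in lim; apply: cvg_seq_squeeze lim _ => k.
have h0 := step_gt0 k.
have [b bE] := nstepsD k s0 t0.
set a := euler k s (euler k t x).
have ea : rnorm (euler k (s + t) x - a) <= step k * rnorm y.
  rewrite /a /euler bE iterD iterD.
  apply: le_trans (euler_bool b h0 (euler_rel _ h0 (euler_rel _ h0 Ay))) _.
  rewrite ler_wpM2l ?(ltW h0)//.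
  exact: le_trans (euler_le _ _ h0) (euler_le _ _ h0).
have eb : rnorm (a - euler k s (T t x)) <= rnorm (euler k t x - T t x).
  by rewrite /a /euler -eulerB; exact: euler_le.
have -> : euler k (s + t) x - T s (T t x) = (euler k (s + t) x - a)
    + (a - euler k s (T t x)) + (euler k s (T t x) - T s (T t x)).
  by vector_ring.
set c := euler k s (T t x) - T s (T t x).
have := rnormD (euler k (s + t) x - a + (a - euler k s (T t x))) c.
have := rnormD (euler k (s + t) x - a) (a - euler k s (T t x)).
lra.
Qed.

Lemma limit_cvg0 x : T t x @[t --> 0^'+] --> x.
Proof.
apply/cvg_rnorm_lt => e e0; have e3 : 0 < e / 3 by lra.
have [w [v [Av xw]]] := dom_dense x e3.
pose d := e / (3 * (rnorm v + 1)); have v0 := rnorm_ge0 v.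
have d0 : 0 < d by rewrite divr_gt0// mulr_gt0//; lra.
near=> t; have t0 : 0 < t by near: t; exact: nbhs_right_gt.
have td : t < d by near: t; exact: nbhs_right_lt.
have -> : T t x - x = T t (x - w) + (T t w - w) + (w - x).
  by rewrite linearB; vector_ring.
have := rnormD (T t (x - w) + (T t w - w)) (w - x).
have := rnormD (T t (x - w)) (T t w - w).
have := limit_le (x - w) (ltW t0); have := limit_dist (ltW t0) Av.
rewrite (rnormBC w x).
have dE : d * (rnorm v + 1) = e / 3 by rewrite /d; field; lra.
have : t * rnorm v <= d * rnorm v by rewrite ler_wpM2r// ltW.
lra.
Unshelve. all: by end_near. Qed.

Lemma limit_semigroup : contraction_semigroup T.
Proof.
split; last by move=> t t0 x; exact: limit_le.
split; [exact: limit0| |exact: limit_cvg0].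
by move=> s t s0 t0 x; exact: limitD.
Qed.

(** The generator extends [A] by [limit_taylor]. It is dissipative, and a maximal
    dissipative operator has no proper dissipative extension. *)
Lemma generator_limit : generator T = A :> set (hprod X X).
Proof.
have AT x y : A (x, y) -> generator T (x, y).
  move=> Ay /=; apply/cvg_rnorm_lt => e e0; have e4 : 0 < e / 4 by lra.
  have [w [v [Av yw]]] := dom_dense y e4.
  pose d := e / (2 * (rnorm v + 1)); have v0 := rnorm_ge0 v.
  have d0 : 0 < d by rewrite divr_gt0// mulr_gt0//; lra.
  near=> t; have t0 : 0 < t by near: t; exact: nbhs_right_gt.
  have td : t < d by near: t; exact: nbhs_right_lt.
  have -> : t^-1%:C *: (T t x - x) - y = t^-1%:C *: (T t x - x - t%:C *: y).
    by rewrite [in RHS]scalerBr scalerA -rmorphM/= mulVf ?gt_eqF// scale1r.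
  rewrite rnormZ gtr0_norm ?invr_gt0// mulrC ltr_pdivrMr//.
  apply: le_lt_trans (limit_taylor (ltW t0) Ay Av) _; rewrite mulrC ltr_pM2r//.
  have dE : d * (rnorm v + 1) = e / 2 by rewrite /d; field; lra.
  have : t * rnorm v <= d * rnorm v by rewrite ler_wpM2r// ltW.
  lra.
apply/seteqP; split=> -[x y]; last exact: AT.
move=> Txy; have [w [v [Av wv]]] := A_max ltr01 (x - y).
have := generator_dissipative limit_semigroup (linrelB Txy (AT _ _ Av)).
have yv : y - v = x - w.
  move: wv; rewrite scale1r => /eqP; rewrite subr_eq => /eqP ->; vector_ring.
rewrite yv => xw0; have xw : x - w = 0.
  by apply: rdot_eq0; apply/eqP; rewrite eq_le rdot_ge0 xw0.
have -> : x = w by apply/eqP; rewrite -subr_eq0 xw.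
by have -> : y = v by apply/eqP; rewrite -subr_eq0 yv xw.
Unshelve. all: by end_near. Qed.

End Limit.
End ImplicitEuler.

(** Maximality provides the resolvents; their powers along the dyadic grids
    converge to the semigroup. *)
Theorem lumer_phillips : exists T : R -> bop X X,
  contraction_semigroup T /\ generator T = A :> set (hprod X X).
Proof.
have [J JP] := resolvents_ex; have [T TP] := euler_limit JP.
exists T; split; first exact: limit_semigroup TP.
exact: generator_limit TP.
Qed.

End Generation.

(** * Semi-uniform stability from compactness *)

(** A discrete substitute for integrating a one-sided derivative: a real function
    whose increments are at most [h * g t], up to [o(h)] uniformly in [t]. *)
Lemma increment_bound (R : realType) (phi g : R -> R) (tau kappa : R) :
  (forall e, 0 < e -> exists2 d, 0 < d & forall h t, 0 < h -> h < d -> 0 <= t ->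
    phi (t + h) <= phi t + h * g t + h * e) ->
  0 <= tau -> (forall s, 0 <= s -> s <= tau -> g s <= kappa) ->
  phi tau <= phi 0 + tau * kappa.
Proof.
move=> inc tau0 gk; have [->|tauN0] := eqVneq tau 0; first by rewrite mul0r addr0.
have {tauN0}tau0' : 0 < tau by rewrite lt_neqAle eq_sym tauN0.
apply/ler_addgt0Pr => e e0; have [d d0 dP] := inc _ (divr_gt0 e0 tau0').
pose n := (Num.truncn (tau / d)).+1.
have nP : tau / d < n%:R by exact: truncnS_gt.
have n0 : 0 < n%:R :> R by rewrite ltr0n.
pose h := tau / n%:R; have h0 : 0 < h by rewrite divr_gt0.
have hd : h < d by rewrite ltr_pdivrMr// mulrC -ltr_pdivrMr.
have nh : n%:R * h = tau by rewrite mulrC divfK// gt_eqF.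
have H j : (j <= n)%N -> phi (j%:R * h) <= phi 0 + j%:R * h * (kappa + e / tau).
  elim: j => [|j IH] jn; first by rewrite !mul0r addr0.
  have jh0 : 0 <= j%:R * h by rewrite mulr_ge0// ltW.
  have := dP h _ h0 hd jh0; have := IH (ltnW jn).
  have : g (j%:R * h) <= kappa.
    by apply: gk => //; rewrite -nh ler_wpM2r ?(ltW h0)// ler_nat ltnW.
  rewrite -natr1 mulrDl mul1r => /(ler_wpM2l (ltW h0)); lra.
have := H n (leqnn n); rewrite nh mulrDr [tau * (e / tau)]mulrC divfK ?gt_eqF//.
lra.
Qed.

Section Stability.
Context (R : realType) (X : preHilbertType R) (T : R -> bop X X).
Hypothesis T_contr : contraction_semigroup T.
Local Notation A := (generator T).

Let T_le (t : R) x : 0 <= t -> rnorm (T t x) <= rnorm x.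
Proof. by move=> t0; have [_] := T_contr; exact. Qed.

Let T0 x : T 0 x = x.
Proof. by have [[]] := T_contr. Qed.

Let TD (s t : R) x : 0 <= s -> 0 <= t -> T (s + t) x = T s (T t x).
Proof. by move=> s0 t0; have [[_ TD _] _] := T_contr; exact: TD. Qed.

Lemma semigroup_mono (s t : R) x :
  0 <= s -> s <= t -> rnorm (T t x) <= rnorm (T s x).
Proof.
move=> s0 st; have -> : t = (t - s) + s by rewrite subrK.
by rewrite TD ?subr_ge0// T_le// subr_ge0.
Qed.

Lemma generator_rel (t : R) x y : 0 <= t -> A (x, y) -> A (T t x, T t y).
Proof.
move=> t0 Axy.
have lim : T t (h^-1%:C *: (T h x - x)) @[h --> 0^'+] --> (T t y : X).
  exact: cvg_bop Axy.
rewrite /=; apply: cvg_trans lim; apply: near_eq_cvg.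
near=> h; have h0 : 0 <= h by near: h; exact: nbhs_right_ge.
by rewrite linearZ linearB/= -!TD// (addrC t h).
Unshelve. all: by end_near. Qed.

Lemma generator_single : single_valued A.
Proof. by move=> x y1 y2 /= h1 h2; exact: cvg_unique h1 h2. Qed.

(** The error does not depend on [t], because the expansion at [t] is the image of
    the expansion at [0] under the contraction [T t]. *)
Lemma energy_increment x y : A (x, y) -> forall e : R, 0 < e ->
  exists2 d : R, 0 < d & forall h t : R, 0 < h -> h < d -> 0 <= t ->
  `|rnorm (T (t + h) x) ^+ 2 - rnorm (T t x) ^+ 2
    - h * (2 * rdot (T t y) (T t x))| <= h * e.
Proof.
move=> Axy e e0; set a := rnorm x; set b := rnorm y.
have a0 : 0 <= a by exact: rnorm_ge0. have b0 : 0 <= b by exact: rnorm_ge0.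
pose eta := Num.min 1 (e / (4 * (a + 1))).
have eta0 : 0 < eta by rewrite lt_min ltr01 divr_gt0// mulr_gt0//; lra.
have eta1 : eta <= 1 by rewrite ge_min lexx.
have etae : eta * a <= e / 4.
  have : eta * (4 * (a + 1)) <= e.
    by rewrite -ler_pdivlMr ?mulr_gt0//; [rewrite ge_min lexx orbT|lra].
  lra.
have := (cvg_rnorm_lt _ _).1 Axy _ eta0.
rewrite near_withinE => -[d /= d0 dP].
pose d' := Num.min d (e / (2 * (b + 1) ^+ 2)).
have b2 : 0 < 2 * (b + 1) ^+ 2 by rewrite mulr_gt0// exprn_gt0//; lra.
exists d'; first by rewrite lt_min d0 divr_gt0.
move=> h t h0; rewrite lt_min => /andP[hd he] t0.
set r := h^-1%:C *: (T h x - x) - y.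
have r1 : rnorm r < eta by apply: dP => //=; rewrite sub0r normrN gtr0_norm.
have TE : T (t + h) x = T t x + h%:C *: (T t y + T t r).
  rewrite TD// ?ltW// -linearD -linearZ -linearD; congr (T t _).
  rewrite /r addrCA subrr addr0 scalerA -rmorphM/= mulfV ?gt_eqF// scale1r.
  by rewrite addrCA subrr addr0.
rewrite TE; set u := T t x; set v := T t y; set w := T t r.
have ua : rnorm u <= a by exact: T_le. have vb : rnorm v <= b by exact: T_le.
have wr : rnorm w <= eta by apply: le_trans (T_le _ t0) (ltW r1).
have -> : rnorm (u + h%:C *: (v + w)) ^+ 2 - rnorm u ^+ 2 - h * (2 * rdot v u)
    = h * (2 * rdot w u + h * rnorm (v + w) ^+ 2).
  by rewrite !rnormK !rdotE (rdotC u v) (rdotC u w) (rdotC w v); ring.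
rewrite normrM (gtr0_norm h0) ler_wpM2l ?(ltW h0)//.
apply: le_trans (ler_normD _ _) _.
have wu : `|2 * rdot w u| <= e / 2.
  rewrite normrM ger0_norm//; have := rdot_norm w u.
  have : rnorm w * rnorm u <= eta * a by apply: ler_pM => //; exact: rnorm_ge0.
  lra.
have hv : `|h * rnorm (v + w) ^+ 2| <= e / 2.
  rewrite ger0_norm; last by rewrite mulr_ge0 ?sqr_ge0// ltW.
  have vw : rnorm (v + w) ^+ 2 <= (b + 1) ^+ 2.
    rewrite ler_pXn2r ?nnegrE ?rnorm_ge0//; last lra.
    by apply: le_trans (rnormD _ _) _; lra.
  apply: le_trans (ler_wpM2l (ltW h0) vw) _.
  by move: he; rewrite ltr_pdivlMr//; lra.
lra.
Qed.

Lemma energy_upper x y (tau kappa : R) : A (x, y) -> 0 <= tau ->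
  (forall s, 0 <= s -> s <= tau -> rdot (T s y) (T s x) <= kappa) ->
  rnorm (T tau x) ^+ 2 <= rnorm x ^+ 2 + tau * (2 * kappa).
Proof.
move=> Axy tau0 H.
have := @increment_bound R (fun t => rnorm (T t x) ^+ 2)
  (fun t => 2 * rdot (T t y) (T t x)) tau (2 * kappa).
rewrite T0; apply => //; last by move=> s s0 st; rewrite ler_pM2l// H.
move=> e /(energy_increment Axy)[d d0 dP]; exists d => // h t h0 hd t0.
by have := dP h t h0 hd t0; rewrite ler_norml; lra.
Qed.

Lemma energy_lower x y (tau kappa : R) : A (x, y) -> 0 <= tau ->
  (forall s, 0 <= s -> s <= tau -> kappa <= rdot (T s y) (T s x)) ->
  rnorm x ^+ 2 + tau * (2 * kappa) <= rnorm (T tau x) ^+ 2.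
Proof.
move=> Axy tau0 H.
have := @increment_bound R (fun t => - rnorm (T t x) ^+ 2)
  (fun t => - (2 * rdot (T t y) (T t x))) tau (- (2 * kappa)).
rewrite T0 => E.
suff : - rnorm (T tau x) ^+ 2 <= - rnorm x ^+ 2 + tau * - (2 * kappa) by lra.
apply: E => //; last by move=> s s0 st; rewrite lerN2 ler_pM2l// H.
move=> e /(energy_increment Axy)[d d0 dP]; exists d => // h t h0 hd t0.
by have := dP h t h0 hd t0; rewrite ler_norml; lra.
Qed.

Definition isometric z := forall t : R, 0 <= t -> rnorm (T t z) = rnorm z.

(** [rnorm (z + a w) ^+ 2 - rnorm (T t (z + a w)) ^+ 2] is a nonnegative quadratic
    function of [a] without constant term. *)
Lemma isometric_rdot (t : R) z w : 0 <= t -> isometric z ->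
  rdot (T t z) (T t w) = rdot z w.
Proof.
move=> t0 iz; apply/esym/eqP; rewrite -subr_eq0; apply/eqP.
suff : (rdot z w - rdot (T t z) (T t w)) *+ 2 = 0.
  by move/eqP; rewrite mulrn_eq0 => /eqP.
apply: (@linear_coef_eq0 _ _ (rdot w w - rdot (T t w) (T t w))) => [|a].
  by rewrite subr_ge0 -ler_rnorm T_le.
have := T_le (z + a%:C *: w) t0; rewrite ler_rnorm linearD linearZ/=.
have := congr1 (fun r => r ^+ 2) (iz t t0); rewrite !rnormK.
rewrite !rdotE (rdotC w z) (rdotC (T t w)); lra.
Qed.

Lemma isometricD z w : isometric z -> isometric w -> isometric (z + w).
Proof.
move=> iz iw t t0; apply/eqP; rewrite -(@eqrXn2 _ 2) ?rnorm_ge0//; apply/eqP.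
by rewrite !rnormK linearD !rdotE !isometric_rdot.
Qed.

Lemma isometricZ (a : R) z : isometric z -> isometric (a%:C *: z).
Proof. by move=> iz t t0; rewrite linearZ/= !rnormZ iz. Qed.

(** For [A x = z] with [z] isometric, [rnorm (T t x) ^+ 2] is affine in [t] with
    slope [2 * rdot z x <= 0], and bounded below; hence it is constant. *)
Lemma isometric_preimage x z : isometric z -> A (x, z) ->
  isometric x /\ rdot z x = 0.
Proof.
move=> iz Axz; have zx0 := generator_dissipative T_contr Axz.
have up (t : R) : 0 <= t -> rnorm (T t x) ^+ 2 <= rnorm x ^+ 2 + t * (2 * rdot z x).
  by move=> t0; apply: energy_upper Axz t0 _ => s s0 _; rewrite isometric_rdot.
have low (t : R) : 0 <= t -> rnorm x ^+ 2 + t * (2 * rdot z x) <= rnorm (T t x) ^+ 2.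
  by move=> t0; apply: energy_lower Axz t0 _ => s s0 _; rewrite isometric_rdot.
have zx : rdot z x = 0.
  apply/eqP; rewrite eq_le zx0 leNgt; apply/negP => zxn.
  pose t := (rnorm x ^+ 2 + 1) / (- 2 * rdot z x).
  have q0 : 0 < - 2 * rdot z x by lra.
  have t0 : 0 <= t by rewrite divr_ge0 ?addr_ge0 ?sqr_ge0// ltW.
  have tE : t * (- 2 * rdot z x) = rnorm x ^+ 2 + 1 by rewrite /t divfK// gt_eqF.
  have := up t t0; have := sqr_ge0 (rnorm (T t x)); lra.
split=> // t t0; apply/eqP; rewrite -(@eqrXn2 _ 2) ?rnorm_ge0// eq_le.
by have := up t t0; have := low t t0; rewrite zx !mulr0 !addr0 => -> ->.
Qed.

Variable M : R.
Hypothesis A_onto : forall y, exists x, A (x, y).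
Hypothesis A_below : forall x y, A (x, y) -> rnorm x <= M * rnorm y.
Hypothesis A_compact : forall (x y : nat -> X) (B : R), (forall n, A (x n, y n)) ->
  (forall n, rnorm (x n) <= B) -> (forall n, rnorm (y n) <= B) ->
  (fun n => rdot (y n) (x n)) @ \oo --> (0 : R) -> has_cvg_subseq x.
Hypothesis A_point : forall (lambda : R) x, lambda != 0 ->
  A (x, ('i%C * lambda%:C) *: x) -> x = 0.

Lemma generator_inverse : exists S : bop X X, forall y, A (S y, y).
Proof.
have /choice[s sP] := A_onto.
have uni x y : A (x, y) -> x = s y.
  move=> Axy; apply/eqP; rewrite -subr_eq0; apply/eqP/rnorm0_eq0/eqP.
  rewrite eq_le rnorm_ge0 andbT.
  by have := A_below (linrelB Axy (sP y)); rewrite subrr rnorm0 mulr0.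
have [||S SE] := @bop_of _ _ _ s M.
- by move=> a y z; apply/esym/uni; exact: linrelD (linrelZ a (sP y)) (sP z).
- by move=> y; exact: A_below.
by exists S => y; rewrite SE.
Qed.

(** On the isometric vectors the inverse of the generator is skew-adjoint and
    compact. A maximizing sequence for its norm therefore yields an eigenvector
    of its square for the eigenvalue [- m2], and [S ^+ 2 + m2] factors over the
    complex numbers. *)
Lemma isometric_eq0 z : isometric z -> z = 0.
Proof.
move=> iz; apply: contrapT => zN0.
have [S AS] := generator_inverse.
have iS f : isometric f -> isometric (S f) by move=> /isometric_preimage/(_ (AS f))[].
have S_skew f : isometric f -> rdot f (S f) = 0.
  by move=> /isometric_preimage/(_ (AS f))[].
have [K K0 S_le] := bop_rnorm S.
pose E : set R := [set rnorm (S f) ^+ 2 | f in [set f | isometric f /\ rnorm f <= 1]].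
have Eub : has_ubound E.
  exists (K ^+ 2) => _ [f [_ f1] <-].
  rewrite ler_pXn2r ?nnegrE ?rnorm_ge0//.
  by apply: le_trans (S_le f) _; rewrite ler_piMr.
have i0 : isometric 0 by move=> t t0; rewrite linear0.
have supE : has_sup E.
  by split=> //; exists (rnorm (S 0) ^+ 2), 0 => //; split=> //; rewrite rnorm0.
pose m2 := sup E.
have S_sup g : isometric g -> rnorm (S g) ^+ 2 <= m2 * rnorm g ^+ 2.
  move=> ig; have [->|gN0] := eqVneq g 0.
    by rewrite linear0 rnorm0 expr0n mulr0.
  have g0 : 0 < rnorm g.
    rewrite lt_neqAle rnorm_ge0 andbT eq_sym; apply: contra gN0 => /eqP.
    by move/rnorm0_eq0 ->.
  have : rnorm (S ((rnorm g)^-1%:C *: g)) ^+ 2 <= m2.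
    apply: ub_le_sup => //; exists ((rnorm g)^-1%:C *: g) => //; split.
      exact: isometricZ.
    by rewrite rnormZ gtr0_norm ?invr_gt0// mulVf// gt_eqF.
  rewrite linearZ/= rnormZ gtr0_norm ?invr_gt0// exprMn exprVn mulrC.
  by rewrite ler_pdivrMr// exprn_gt0.
have m20 : 0 < m2.
  have Sz : 0 < rnorm (S z) ^+ 2.
    rewrite exprn_gt0// lt_neqAle rnorm_ge0 andbT eq_sym; apply/eqP.
    move=> /rnorm0_eq0 Sz0; apply: zN0; have := AS z; rewrite Sz0 => /generator_single.
    by apply; exact: (lsubspace0 A).
  rewrite ltNge; apply/negP => m2n; have := S_sup z iz.
  have : m2 * rnorm z ^+ 2 <= 0 by rewrite mulr_le0_ge0// sqr_ge0.
  lra.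
have /choice[f fP] (n : nat) : exists f, [/\ isometric f, rnorm f <= 1 &
    m2 - n.+1%:R^-1 < rnorm (S f) ^+ 2].
  have n0 : 0 < n.+1%:R^-1 :> R by rewrite invr_gt0.
  by have [_ [f [i1 f1] <-] fm] := sup_adherent n0 supE; exists f.
have fi n : isometric (f n) by have [] := fP n.
have f1 n : rnorm (f n) <= 1 by have [] := fP n.
have Sf n : rnorm (S (f n)) <= Num.max 1 K.
  by apply: le_trans (S_le _) _; rewrite le_max ler_piMr// orbT.
have [k [g [kn kg]]] : has_cvg_subseq (S \o f).
  apply: (A_compact (y := f) (B := Num.max 1 K)) => [n|n|n|] /=.
  - exact: AS.
  - exact: Sf.
  - by rewrite le_max f1.
  - rewrite (_ : (fun _ => _) = fun=> 0); first exact: cvg_cst.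
    by apply/funext => n; exact: S_skew.
have g_norm : m2 <= rnorm g ^+ 2.
  have lim : (fun n => m2 - n.+1%:R^-1) @ \oo --> m2.
    rewrite -[X in _ --> X]subr0; apply: cvgB; first exact: cvg_cst.
    exact: cvg_harmonic.
  apply: ler_cvg_to (cvg_subseq kn lim) (cvg_sqr_rnorm kg) _.
  by apply: nearW => n /=; apply: ltW; have [] := fP (k n).
have D_le n : rnorm (S (S (f n)) + m2%:C *: f n) ^+ 2 <= m2 * n.+1%:R^-1.
  have := S_skew _ (isometricD (iS _ (fi n)) (fi n)).
  rewrite linearD !rdotE (S_skew _ (fi n)) (S_skew _ (iS _ (fi n))) addr0 add0r.
  rewrite -rnormK => SSf; rewrite rnormK !rdotE -rnormK.
  have := S_sup _ (iS _ (fi n)); rewrite (rdotC (S (S (f n)))).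
  have -> : rdot (f n) (S (S (f n))) = - rnorm (S (f n)) ^+ 2 by lra.
  have [_ _] := fP n => /ltW /(ler_wpM2l (ltW m20)).
  have : rdot (f n) (f n) <= 1 by rewrite -rnormK exprn_ile1// rnorm_ge0.
  move=> /(ler_wpM2l (sqr_ge0 m2)); set i := n.+1%:R^-1; lra.
(* The defect of the eigenvalue equation at [f n] tends to zero; one more
   application of [S] transfers this to [S (f n)], which converges. *)
have eigen : S (S g) + m2%:C *: g = 0.
  have lim : (fun n => S (S ((S \o f \o k) n)) + m2%:C *: (S \o f \o k) n) @ \oo
      --> (S (S g) + m2%:C *: g : X).
    apply: cvgD; last by apply: cvgZl_tmp.
    by apply: cvg_bop; apply: cvg_bop.
  apply: (cvg_unique _ lim) => //.
  rewrite (_ : (fun _ => _) = (fun n => S (S (S (f n)) + m2%:C *: f n)) \o k); last first.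
    by apply/funext => n /=; rewrite linearD linearZ.
  apply: cvg_subseq kn _.
  rewrite -(linear0 S); apply: cvg_bop.
  apply/cvg_seq_lt => e e0.
  have e2 : 0 < e ^+ 2 / m2 by rewrite divr_gt0// exprn_gt0.
  have [N _ NP] := cvgr0_norm_lt _ (@cvg_harmonic R) _ e2.
  exists N => n /NP; rewrite /harmonic/= ger0_norm ?invr_ge0// ltr_pdivlMr// subr0 => ne.
  rewrite -(@ltr_pXn2r _ 2) ?nnegrE ?rnorm_ge0 ?ltW//.
  by apply: le_lt_trans (D_le n) _; rewrite mulrC.
have gN0 : g <> 0.
  by move=> g0; move: g_norm; rewrite g0 rnorm0 expr0n/=; lra.
pose m := Num.sqrt m2; have m0 : 0 < m by rewrite sqrtr_gt0.
have mm : m * m = m2 by rewrite -expr2 sqr_sqrtr// ltW.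
have mN0 : m != 0 by rewrite gt_eqF.
have ii : 'i%C * 'i%C = -1 :> R[i] by rewrite -expr2 sqr_i.
pose e := S g + ('i%C * m%:C) *: g.
have [e0|eN0] := pselect (e = 0).
  apply: gN0; apply: (@A_point m^-1); first by rewrite invr_eq0.
  have Sg : S g = - ('i%C * m%:C) *: g.
    by apply/eqP; rewrite scaleNr -addr_eq0 -/e e0.
  have := linrelZ ('i%C * m^-1%:C) (AS g); rewrite Sg scalerA.
  have -> : 'i%C * m^-1%:C * - ('i%C * m%:C) = 1 :> R[i].
    rewrite mulrN mulrACA ii -rmorphM/= mulVf//.
    by rewrite mulN1r opprK.
  by rewrite scale1r.
apply: eN0; apply: (@A_point (- m^-1)); first by rewrite oppr_eq0 invr_eq0.
have Se : S e = ('i%C * m%:C) *: e.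
  have SSg : S (S g) = - (m2%:C *: g) by apply/eqP; rewrite -addr_eq0 eigen.
  rewrite /e linearD linearZ/= SSg scalerDr scalerA mulrACA ii -rmorphM/= mm.
  by rewrite mulN1r scaleNr addrC.
have := linrelZ ('i%C * (- m^-1)%:C) (AS e); rewrite Se scalerA.
have -> : 'i%C * (- m^-1)%:C * ('i%C * m%:C) = 1 :> R[i].
  by rewrite mulrACA ii -rmorphM/= [- m^-1 * m]mulNr mulVf// rmorphN1 mulrNN mulr1.
by rewrite scale1r.
Qed.

(** If the decay were not uniform, some trajectories starting in the unit ball of
    the domain would stay above [e] for an arbitrarily long time. They lose
    little energy on a long piece of it; at some moment the dissipation is small
    too, so compactness gives a nonzero isometric vector. *)
Lemma uniform_decay (e : R) : 0 < e -> exists2 t0 : R, 0 <= t0 &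
  forall t x y, t0 <= t -> A (x, y) -> rnorm x <= 1 -> rnorm y <= 1 ->
  rnorm (T t x) <= e.
Proof.
move=> e0; apply: contrapT => ndecay.
have slow (t0 : R) : 0 <= t0 -> exists x y,
    [/\ A (x, y), rnorm x <= 1, rnorm y <= 1 & e < rnorm (T t0 x)].
  move=> t00; apply: contrapT => nx; apply: ndecay; exists t0 => // t x y t0t Axy x1 y1.
  rewrite leNgt; apply/negP => ex; apply: nx; exists x, y; split=> //.
  exact: lt_le_trans ex (semigroup_mono _ t00 t0t).
have piece (m : nat) : exists zy : X * X, [/\ A (zy.1, zy.2),
    rnorm zy.1 <= 1, rnorm zy.2 <= 1, e < rnorm zy.1 &
    - m.+1%:R^-1 < rdot zy.2 zy.1 /\ forall t : R, 0 <= t -> t <= m%:R ->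
      rnorm zy.1 ^+ 2 - rnorm (T t zy.1) ^+ 2 <= m.+1%:R^-1].
  set r : R := m.+1%:R^-1; have r0 : 0 < r by rewrite invr_gt0.
  have m0 : 0 < m.+1%:R :> R by [].
  have rm : m.+1%:R * r = 1 by rewrite mulfV// gt_eqF.
  have mm0 : 0 <= m.+1%:R * m.+1%:R :> R by rewrite mulr_ge0.
  have [x [y [Axy x1 y1 ex]]] := slow _ mm0.
  (* The initial energy is at most one, so that on one of [m.+1] consecutive
     intervals of length [m.+1] at most [r] of it is lost. *)
  have [j jm small] : exists2 j, (j < m.+1)%N &
      rnorm (T (j%:R * m.+1%:R) x) ^+ 2 - rnorm (T (j.+1%:R * m.+1%:R) x) ^+ 2 <= r.
    apply: contrapT => nj.
    have big j : (j <= m.+1)%N ->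
        rnorm (T (j%:R * m.+1%:R) x) ^+ 2 <= rnorm x ^+ 2 - j%:R * r.
      elim: j => [|j IH] jm; first by rewrite !mul0r T0 subr0.
      apply: le_trans (_ : rnorm (T (j%:R * m.+1%:R) x) ^+ 2 - r <= _); last first.
        by have := IH (ltnW jm); rewrite -natr1; lra.
      by rewrite leNgt; apply/negP => bj; apply: nj; exists j => //; lra.
    have := big _ (leqnn _); rewrite rm.
    have : rnorm x ^+ 2 <= 1 by rewrite exprn_ile1// rnorm_ge0.
    have : e ^+ 2 < rnorm (T (m.+1%:R * m.+1%:R) x) ^+ 2.
      by rewrite ltr_pXn2r ?nnegrE ?rnorm_ge0 ?(ltW e0).
    have := sqr_ge0 e; lra.
  set a : R := j%:R * m.+1%:R; have a0 : 0 <= a by rewrite mulr_ge0.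
  have Sa : j.+1%:R * m.+1%:R = m.+1%:R + a :> R by rewrite /a -[j.+1%:R]natr1; ring.
  rewrite Sa -/a in small.
  (* The dissipated energy cannot exceed [r] throughout the first unit of
     time of this interval. *)
  have [s s0 [s1 sP]] : exists2 s : R, 0 <= s &
      s <= 1 /\ - r < rdot (T s (T a y)) (T s (T a x)).
    apply: contrapT => ns.
    have := @energy_upper (T a x) (T a y) 1 (- r) (generator_rel a0 Axy) ler01.
    have -> : rnorm (T 1 (T a x)) ^+ 2 <= rnorm (T a x) ^+ 2 + 1 * (2 * - r) = false.
      apply/negbTE; rewrite -ltNge.
      have : rnorm (T (m.+1%:R + a) x) ^+ 2 <= rnorm (T 1 (T a x)) ^+ 2.
        rewrite ler_pXn2r ?nnegrE ?rnorm_ge0// -TD//; apply: semigroup_mono.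
          by rewrite addr_ge0.
        by rewrite lerD2r ler1n.
      lra.
    suff H : forall s : R, 0 <= s -> s <= 1 ->
      rdot (T s (T a y)) (T s (T a x)) <= - r by move=> /(_ H).
    by move=> s s0 s1; rewrite leNgt; apply/negP => h; apply: ns; exists s.
  exists (T s (T a x), T s (T a y)) => /=.
  have late (t : R) : 0 <= t -> t <= m%:R ->
      rnorm (T (m.+1%:R + a) x) <= rnorm (T t (T s (T a x))).
    move=> t0 tm; rewrite -!TD ?addr_ge0//; apply: semigroup_mono.
      by rewrite !addr_ge0.
    by rewrite lerD2r -natr1; lra.
  split.
  - exact/generator_rel/generator_rel.
  - by do 2! (apply: le_trans (T_le _ _) _ => //).
  - by do 2! (apply: le_trans (T_le _ _) _ => //).
  - have := late 0 (lexx 0) (ler0n _ _); rewrite T0; apply: lt_le_trans.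
    apply: lt_le_trans ex _; apply: semigroup_mono; first by rewrite addr_ge0.
    by rewrite -Sa ler_wpM2r// ler_nat.
  - split=> // t t0 tm.
    have : rnorm (T (m.+1%:R + a) x) ^+ 2 <= rnorm (T t (T s (T a x))) ^+ 2.
      by rewrite ler_pXn2r ?nnegrE ?rnorm_ge0// late.
    have : rnorm (T s (T a x)) ^+ 2 <= rnorm (T a x) ^+ 2.
      by rewrite ler_pXn2r ?nnegrE ?rnorm_ge0// T_le.
    lra.
have /choice[p pP] := piece.
have [k [z [kn kz]]] : has_cvg_subseq (fun n => (p n).1).
  apply: (A_compact (y := fun n => (p n).2) (B := 1)).
  - by move=> n; have [] := pP n.
  - by move=> n; have [] := pP n.
  - by move=> n; have [] := pP n.
  - have h0 : (fun n => - n.+1%:R^-1 : R) @ \oo --> (0 : R).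
      by rewrite -[X in _ --> X]oppr0; apply: cvgN; exact: cvg_harmonic.
    apply: (squeeze_cvgr _ h0 (cvg_cst 0)); apply: nearW => n.
    have [Ap _ _ _ [/ltW -> _]] := pP n.
    exact: generator_dissipative Ap.
have ez : e <= rnorm z.
  apply: ler_cvg_to (cvg_cst e) (cvg_rnorm kz) _; apply: nearW => n /=.
  by apply: ltW; have [] := pP (k n).
have iz : isometric z.
  move=> t t0; apply/eqP; rewrite -(@eqrXn2 _ 2) ?rnorm_ge0// eq_le; apply/andP; split.
    by rewrite ler_pXn2r ?nnegrE ?rnorm_ge0// T_le.
  rewrite -subr_le0.
  have lim : (fun n => rnorm (p (k n)).1 ^+ 2 - rnorm (T t (p (k n)).1) ^+ 2) @ \oo
      --> rnorm z ^+ 2 - rnorm (T t z) ^+ 2.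
    by apply: cvgB; [exact: cvg_sqr_rnorm|apply: cvg_sqr_rnorm; exact: cvg_bop].
  have h0 : (fun n => (k n).+1%:R^-1 : R) @ \oo --> (0 : R).
    exact: (cvg_subseq kn (@cvg_harmonic R)).
  apply: ler_cvg_to lim h0 _; exists (Num.truncn t).+1 => // n /= tn.
  have [_ _ _ _ [_ H]] := pP (k n); apply: H => //.
  apply: ltW; apply: lt_le_trans (truncnS_gt t) _.
  by rewrite ler_nat (leq_trans tn).
by move: ez; rewrite (isometric_eq0 iz) rnorm0; lra.
Qed.

Theorem semi_uniform_stability : semi_uniformly_stable T.
Proof.
pose E (t : R) : set R := [set r | exists x y,
  [/\ A (x, y), rnorm ((x, y) : hprod X X) <= 1 & r = rnorm (T t x)]].
have graph1 x y : rnorm ((x, y) : hprod X X) <= 1 -> rnorm x <= 1 /\ rnorm y <= 1.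
  by have [/= a b _] := rnorm_hprod_le ((x, y) : hprod X X) => h; split; lra.
have E0 t : E t 0.
  exists 0, 0; split; [exact: (lsubspace0 A)| |by rewrite linear0 rnorm0].
  by rewrite (_ : (0, 0) = 0)// rnorm0.
have Eub t : 0 <= t -> has_ubound (E t).
  move=> t0; exists 1 => _ [x [y [_ /graph1[x1 _] ->]]].
  exact: le_trans (T_le _ t0) x1.
exists (fun t => sup (E t)); split.
- by move=> t t0; apply: ub_le_sup (E0 t); exact: Eub.
- apply/cvgrPdistC_le => e e0; have [t0 t00 tP] := uniform_decay e0.
  near=> t; have t0t : t0 <= t by near: t; apply: nbhs_pinfty_ge; exact: num_real.
  have t_ge0 := le_trans t00 t0t.
  rewrite subr0 ger0_norm; last by apply: ub_le_sup (E0 t); exact: Eub.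
  apply: ge_sup; first by exists 0.
  by move=> _ [x [y [Axy /graph1[x1 y1] ->]]]; exact: tP Axy x1 y1.
- move=> t t0 x y Axy; rewrite !normE -rmorphM/= lecR.
  set r := rnorm ((x, y) : hprod X X); have [r0|rN0] := eqVneq r 0.
    have [/= xr _ _] := rnorm_hprod_le ((x, y) : hprod X X).
    rewrite r0 mulr0; apply: le_trans (T_le _ t0) _.
    by apply: le_trans xr _; rewrite -/r r0.
  have r0 : 0 < r by rewrite lt_neqAle eq_sym rN0 rnorm_ge0.
  rewrite -ler_pdivrMr// mulrC; apply: ub_le_sup; first exact: Eub.
  exists (r^-1%:C *: x), (r^-1%:C *: y); split; first exact: linrelZ.
    have -> : (r^-1%:C *: x, r^-1%:C *: y) = r^-1%:C *: ((x, y) : hprod X X) by [].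
    by rewrite rnormZ gtr0_norm ?invr_gt0// -/r mulVf.
  by rewrite linearZ/= rnormZ gtr0_norm ?invr_gt0.
Unshelve. all: by end_near. Qed.

End Stability.

(** * Damping operators that are coercive up to a self-adjoint part *)

(** For the values of a possibly degenerate form on a line this is the
    Cauchy-Schwarz inequality. *)
Lemma discriminant_le (R : realType) (p s r : R) :
  0 <= r -> (forall a, 0 <= p + a * (2 * s) + a ^+ 2 * r) -> s ^+ 2 <= p * r.
Proof.
move=> r0 H; have [r00|rN0] := eqVneq r 0.
  have [->|sN0] := eqVneq s 0; first by rewrite r00 mulr0 expr0n.
  have := H (- (p + 1) / (2 * s)); rewrite divfK ?mulf_neq0// r00; lra.
have rp : 0 < r by rewrite lt_neqAle eq_sym rN0.
have := H (- s / r).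
have -> : p + - s / r * (2 * s) + (- s / r) ^+ 2 * r = p - s ^+ 2 / r by field.
by rewrite subr_ge0 ler_pdivrMr.
Qed.

Lemma rdot_adjoint (R : realType) (X Y : preHilbertType R) (A : linrel X Y) y x :
  adjoint A (y, x) <-> forall u v, A (u, v) -> rdot v y = rdot u x.
Proof.
split=> [Axy u v Auv|H u v Auv]; first by rewrite /rdot (Axy u v).
by rewrite !innerE (H _ _ Auv) (H _ _ (linrelZ 'i%C Auv)).
Qed.

Lemma lr_ge_rdot (R : realType) (X : preHilbertType R) (A : linrel X X) (c : R) x y :
  lr_ge A c -> A (x, y) -> c * rdot x x <= rdot y x.
Proof.
move=> Ac /Ac; rewrite lecE => /andP[_]; rewrite /rdot.
by case: (inner x x) => a b /=; rewrite mul0r subr0.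
Qed.

Lemma Re_coercive (R : realType) (X : preHilbertType R) (g : bop X X) (c : R) x :
  seq_complete X -> lr_ge (lr_Re (graph g)) c -> c * rdot x x <= rdot (g x) x.
Proof.
move=> cX gc; have [b xb] := bop_adjoint g x cX.
have -> : rdot (g x) x = rdot (2^-1 *: (g x + b)) x.
  have -> : 2^-1 = 2^-1%:C :> R[i] by rewrite fmorphV rmorph_nat.
  by rewrite rdotZl rdotDl (rdotC b) -((rdot_adjoint _ _ _).1 xb x (g x))//; lra.
by apply: lr_ge_rdot gc _; exists (g x + b) => //; exists (g x), b.
Qed.

Lemma rdot_symmetric (R : realType) (X : preHilbertType R) (g : bop X X) x y :
  graph g = adjoint (graph g) :> set (hprod X X) -> rdot (g x) y = rdot x (g y).
Proof.
move=> gg; have gy : adjoint (graph g) (y, g y).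
  by rewrite /lsubspace_mem -gg.
exact: ((rdot_adjoint _ _ _).1 gy).
Qed.

Lemma symmetric_ge0_bound (R : realType) (X : preHilbertType R) (g : bop X X)
    (M : R) x :
  (forall x y, rdot (g x) y = rdot x (g y)) -> (forall x, 0 <= rdot (g x) x) ->
  (forall x, rnorm (g x) <= M * rnorm x) ->
  rnorm (g x) ^+ 2 <= M * rdot (g x) x.
Proof.
move=> g_sym g_ge0 gM.
have CS : (rdot (g x) (g x)) ^+ 2 <= rdot (g x) x * rdot (g (g x)) (g x).
  apply: discriminant_le => // a; have := g_ge0 (x + a%:C *: g x).
  by rewrite linearD linearZ/= !rdotE (g_sym (g x) x); lra.
have gg : rdot (g (g x)) (g x) <= M * rnorm (g x) ^+ 2.
  apply: le_trans (rdot_le _ _) _; rewrite expr2 mulrA.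
  by rewrite ler_wpM2r ?rnorm_ge0.
rewrite -rnormK in CS; set a := rnorm (g x) ^+ 2 in CS gg *.
have [a0|aN0] := eqVneq a 0.
  have [->|xN0] := eqVneq x 0; first by rewrite a0 rdot0r mulr0.
  have xp : 0 < rnorm x.
    rewrite lt_neqAle rnorm_ge0 andbT eq_sym; apply: contra xN0 => /eqP.
    by move/rnorm0_eq0 ->.
  rewrite a0 mulr_ge0// -(pmulr_lge0 _ xp).
  by apply: le_trans (gM x); exact: rnorm_ge0.
have a0 : 0 < a by rewrite lt_neqAle eq_sym aN0 sqr_ge0.
rewrite -(ler_pM2r a0) -expr2; apply: le_trans CS _.
by rewrite [leRHS]mulrAC [leRHS]mulrC ler_wpM2l.
Qed.

(** Both bounds say that [gamma] is controlled by the dissipated energy: on [U]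
    because the latter is coercive there, on the complement by the
    Cauchy-Schwarz inequality for the nonnegative form of the self-adjoint
    part. *)
Lemma damping_bounds (R : realType) (H : preHilbertType R) (gamma : bop H H)
    (U : lsubspace H) (c : R) (gammaU : bop (subsp U) (subsp U))
    (gammaV : bop (subsp (orth U)) (subsp (orth U))) :
  seq_complete H -> closed (U : set H) -> 0 < c ->
  lr_ge (lr_Re (graph gammaU)) c ->
  graph gammaV = adjoint (graph gammaV)
    :> set (hprod (subsp (orth U)) (subsp (orth U))) ->
  lr_ge (graph gammaV) 0 ->
  (forall (x : subsp U) (y : subsp (orth U)),
    gamma (subsp_val x + subsp_val y) =
    subsp_val (gammaU x) + subsp_val (gammaV y)) ->
  exists K : R, 0 <= K /\ forall x,
    [/\ 0 <= rdot (gamma x) x,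
        rnorm (gamma x) ^+ 2 <= K * rdot (gamma x) x &
        forall a, rdot (gamma a) x ^+ 2 <= K * rnorm a ^+ 2 * rdot (gamma x) x].
Proof.
move=> cH cU c0 gUc gV_sym gV0 gE.
have [M1 M10 M1P] := bop_rnorm gammaU; have [M2 M20 M2P] := bop_rnorm gammaV.
have gV_ge0 y : 0 <= rdot (gammaV y) y.
  by have := @lr_ge_rdot _ _ _ _ y (gammaV y) gV0 erefl; rewrite mul0r.
have gV_symm x y : rdot (gammaV x) y = rdot x (gammaV y) by exact: rdot_symmetric.
have gV_bound y := symmetric_ge0_bound y gV_symm gV_ge0 M2P.
have gU_ge x : c * rnorm x ^+ 2 <= rdot (gammaU x) x.
  by rewrite rnormK; apply: Re_coercive gUc; exact: subsp_complete.
pose K := M1 ^+ 2 / c + M2.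
have K1 : 0 <= M1 ^+ 2 / c by rewrite divr_ge0 ?sqr_ge0// ltW.
have K0 : 0 <= K by rewrite addr_ge0.
have decomp x : exists (x1 : subsp U) (x2 : subsp (orth U)),
    x = subsp_val x1 + subsp_val x2.
  have [p [/subsp_ex[x1 <-] /subsp_ex[x2 x2E]]] := projection cH x cU.
  by exists x1, x2; rewrite x2E addrC subrK.
have cross (x1 : subsp U) (x2 : subsp (orth U)) : rdot (subsp_val x1) (subsp_val x2) = 0.
  by rewrite rdotC; have /orth_rdot := subsp_valS x2; apply; exact: subsp_valS.
have split_dot (x1 y1 : subsp U) (x2 y2 : subsp (orth U)) :
    rdot (subsp_val x1 + subsp_val x2) (subsp_val y1 + subsp_val y2)
    = rdot x1 y1 + rdot x2 y2.
  by rewrite !rdotE (rdotC (subsp_val x2) (subsp_val y1)) !cross addr0 add0r.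
have gU_sq x : M1 ^+ 2 * rnorm x ^+ 2 <= M1 ^+ 2 / c * rdot (gammaU x) x.
  have := ler_wpM2l K1 (gU_ge x); rewrite mulrA divfK ?gt_eqF//.
have gU0 x : 0 <= rdot (gammaU x) x.
  by apply: le_trans (gU_ge x); rewrite mulr_ge0 ?sqr_ge0// ltW.
exists (2 * K); split=> [|x]; first by rewrite mulr_ge0.
have [x1 [x2 ->]] := decomp x; rewrite gE split_dot.
have q1 := gU0 x1; have q2 := gV_ge0 x2.
have e1 := gU_sq x1; have e2 := gV_bound x2.
have Kq : M1 ^+ 2 / c * rdot (gammaU x1) x1 + M2 * rdot (gammaV x2) x2
    <= K * (rdot (gammaU x1) x1 + rdot (gammaV x2) x2).
  by rewrite /K; have := mulr_ge0 K1 q2; have := mulr_ge0 M20 q1; lra.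
split; first exact: addr_ge0.
- rewrite [leLHS]rnormK split_dot -!rnormK.
  have : rnorm (gammaU x1) ^+ 2 <= M1 ^+ 2 * rnorm x1 ^+ 2.
    by rewrite -exprMn ler_pXn2r ?nnegrE ?rnorm_ge0// mulr_ge0 ?rnorm_ge0.
  by have := mulr_ge0 K0 (addr_ge0 q1 q2); lra.
- move=> a; have [a1 [a2 ->]] := decomp a; rewrite gE split_dot.
  rewrite [rnorm _ ^+ 2]rnormK split_dot -!rnormK gV_symm.
  set s1 := rdot (gammaU a1) x1; set s2 := rdot a2 (gammaV x2).
  have h1 : s1 ^+ 2 <= rnorm a1 ^+ 2 * (M1 ^+ 2 * rnorm x1 ^+ 2).
    rewrite -!exprMn -(real_normK (num_real s1)) ler_pXn2r ?nnegrE ?mulr_ge0 ?rnorm_ge0//.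
    apply: le_trans (rdot_norm _ _) _.
    by rewrite mulrCA mulrA ler_wpM2r ?rnorm_ge0.
  have h2 : s2 ^+ 2 <= rnorm a2 ^+ 2 * rnorm (gammaV x2) ^+ 2.
    rewrite -!exprMn -(real_normK (num_real s2)) ler_pXn2r ?nnegrE ?mulr_ge0 ?rnorm_ge0//.
    exact: rdot_norm.
  have b1 := sqr_ge0 (rnorm a1); have b2 := sqr_ge0 (rnorm a2).
  set A1 := rnorm a1 ^+ 2 in h1 b1 *; set A2 := rnorm a2 ^+ 2 in h2 b2 *.
  have f1 := ler_wpM2l b1 e1; have f2 := ler_wpM2l b2 e2.
  set q := rdot (gammaU x1) x1 + _ in Kq *.
  have Q1 : M1 ^+ 2 / c * rdot (gammaU x1) x1 <= K * q.
    by have := mulr_ge0 M20 q2; lra.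
  have Q2 : M2 * rdot (gammaV x2) x2 <= K * q by have := mulr_ge0 K1 q1; lra.
  have := ler_wpM2l b1 Q1; have := ler_wpM2l b2 Q2.
  have := sqr_ge0 (s1 - s2).
  have -> : 2 * K * (A1 + A2) * q = 2 * (A1 * (K * q)) + 2 * (A2 * (K * q)) by ring.
  rewrite sqrrB sqrrD; lra.
Qed.

(** * The block operator *)

(** A lower bound by contradiction, from normalized vectors with small images. *)
Lemma below_of_seq (R : realType) (X Y : preHilbertType R) (A : linrel X Y)
    (S : set X) :
  (forall (a : R[i]) x, S x -> S (a *: x)) ->
  (forall (x : nat -> X) (y : nat -> Y), (forall n, A (x n, y n)) ->
    (forall n, S (x n)) -> (forall n, rnorm (x n) = 1) ->
    (forall n, rnorm (y n) <= n.+1%:R^-1) -> False) ->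
  exists M : R, 0 <= M /\ forall x y, A (x, y) -> S x -> rnorm x <= M * rnorm y.
Proof.
move=> SZ H; apply: contrapT => nM.
have /choice[p pP] (n : nat) : exists p : X * Y, [/\ A (p.1, p.2), S p.1,
    rnorm p.1 = 1 & rnorm p.2 <= n.+1%:R^-1].
  apply: contrapT => np; apply: nM; exists n.+1%:R; split=> // x y Axy Sx.
  rewrite leNgt; apply/negP => yx; apply: np.
  have x0 : 0 < rnorm x by apply: le_lt_trans yx; rewrite mulr_ge0 ?rnorm_ge0.
  exists ((rnorm x)^-1%:C *: x, (rnorm x)^-1%:C *: y); split=> /=.
  - exact: linrelZ.
  - exact: SZ.
  - by rewrite rnormZ gtr0_norm ?invr_gt0// mulVf// gt_eqF.
  - rewrite rnormZ gtr0_norm ?invr_gt0// mulrC ler_pdivrMr//.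
    by rewrite ler_pdivlMl// ltW.
apply: (H (fun n => (p n).1) (fun n => (p n).2)) => n; by have [] := pP n.
Qed.

Lemma linrel_closed_seq (R : realType) (X Y : preHilbertType R) (A : linrel X Y)
    (x : nat -> X) (y : nat -> Y) a b : closed (A : set (hprod X Y)) ->
  (forall n, A (x n, y n)) -> x @ \oo --> a -> y @ \oo --> b -> A (a, b).
Proof.
move=> cA Axy xa yb.
have lim : (fun n => (x n, y n) : hprod X Y) @ \oo --> ((a, b) : hprod X Y).
  exact/cvg_hprod.
exact: (closed_seq cA _ lim).
Qed.

Lemma ker_closed (R : realType) (X Y : preHilbertType R) (A : linrel X Y) :
  closed (A : set (hprod X Y)) -> closed (ker A : set X).
Proof.
move=> cA; apply: seq_closed => x a Ax xa.
by apply: linrel_closed_seq cA Ax xa _; exact: cvg_cst.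
Qed.

Section DenseDomain.
Context (R : realType) (X : preHilbertType R) (S : lsubspace X).

(** Approximating [x] by elements orthogonal to it cannot reduce the distance
    below [rnorm x]. *)
Lemma dense_orth0 x : dense (S : set X) -> orth S x -> x = 0.
Proof.
move=> dS /orth_rdot xS; apply: contrapT => x0.
have xp : 0 < rnorm x.
  by rewrite lt_neqAle rnorm_ge0 andbT eq_sym; apply/eqP => /rnorm0_eq0.
have xp' : 0 < (rnorm x)%:C by rewrite ltcR.
have [||y [xy Sy]] := dS (ball x (rnorm x)%:C).
- by exists x; exact: ballxx.
- exact: ball_open.
move: xy; rewrite -ball_normE/= normE ltcR => xy.
have : rnorm x ^+ 2 <= rnorm x * rnorm (x - y).
  have := rdot_le x (x - y); rewrite rdotDr rdotNr (xS y Sy) subr0.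
  by rewrite -rnormK.
by rewrite expr2 ler_pM2l// leNgt xy.
Qed.

End DenseDomain.

Section BlockOperator.
Context (R : realType) (H0 H1 : hilbertType R).
Context (C : linrel H0 H1) (gamma : bop H0 H0).
Hypothesis C_single : single_valued C.
Hypothesis C_dense : dense (dom C : set H0).
Hypothesis C_closed : closed (C : set (hprod H0 H1)).
Hypothesis ran_C_closed : closed (ran C : set H1).
Hypothesis C_compact : compactly_embedded C (orth (ker C)).

Variable K : R.
Hypothesis K_ge0 : 0 <= K.
Hypothesis gamma_ge0 : forall x, 0 <= rdot (gamma x) x.
Hypothesis gamma_bound : forall x, rnorm (gamma x) ^+ 2 <= K * rdot (gamma x) x.
Hypothesis gamma_adj : forall x a,
  rdot (gamma a) x ^+ 2 <= K * rnorm a ^+ 2 * rdot (gamma x) x.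

Local Notation A := (opA C gamma).
Local Notation Cs := (adjoint C).

Let cH0 : seq_complete H0 := @hilbert_complete R H0.
Let cH1 : seq_complete H1 := @hilbert_complete R H1.

Lemma rdot_hprod (p q : hprod H0 H1) : rdot p q = rdot p.1 q.1 + rdot p.2 q.2.
Proof. by rewrite /rdot -raddfD. Qed.

Lemma opAE (u : H0) (v : H1) (f : H0) (g : H1) :
  A ((u, v), (f, g)) <-> C (u, - g) /\ Cs (v, f + gamma u).
Proof.
split.
- move=> [p1 [p2 [[q1 h1 /= ->] [q2 h2 /= ->] e]]].
  case: h1 => a11 [a12 [a21 [a22 [/= e1 e2 e3 e4 q1E]]]].
  case: h2 => b11 [b12 [b21 [b22 [/= e5 [y Cv e6] Cu e7 q2E]]]].
  subst; case: e => -> ->; split.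
    by move: Cu; congr (C (_, _)); rewrite !scaleN1r; vector_ring.
  move: Cv; congr (Cs (_, _)).
  by rewrite !scaleN1r; vector_ring.
- have pN (x : H0) (y : H1) : -1 *: ((x, y) : hprod H0 H1) = (- x, - y).
    by rewrite -(scaleN1r x) -(scaleN1r y).
  move=> [Cu Cv]; exists (- gamma u, 0), (f + gamma u, g); split.
  + exists (gamma u, 0); last by rewrite /= pN oppr0.
    by exists (gamma u), 0, 0, 0; split=> //=; rewrite !addr0.
  + exists (- (f + gamma u), - g); last by rewrite /= pN !opprK.
    exists 0, (- (f + gamma u)), (- g), 0; split=> //=; last by rewrite add0r addr0.
    by exists (f + gamma u) => //; rewrite scaleN1r.
  + by congr pair => /=; rewrite ?add0r// addrC addrK.
Qed.

Lemma adjoint_rdot u c v d : C (u, c) -> Cs (v, d) -> rdot c v = rdot u d.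
Proof. by move=> Cu /rdot_adjoint; exact. Qed.

Lemma opA_energy z r : A (z, r) -> rdot r z = - rdot (gamma z.1) z.1.
Proof.
case: z r => u v [f g] /opAE[Cu Cv]; rewrite rdot_hprod/=.
have := adjoint_rdot Cu Cv; rewrite rdotNl rdotDr (rdotC u f) (rdotC u).
lra.
Qed.

Lemma opA_dissipative : dissipative A.
Proof. by move=> z r /opA_energy ->; rewrite oppr_le0. Qed.

Lemma gamma_eq0 x : rdot (gamma x) x = 0 -> gamma x = 0.
Proof.
move=> x0; have := gamma_bound x; rewrite x0 mulr0 => gx.
by apply/rnorm0_eq0/eqP; rewrite -sqrf_eq0 eq_le gx sqr_ge0.
Qed.

Lemma gamma_ker_orth x a : gamma x = 0 -> rdot (gamma a) x = 0.
Proof.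
move=> x0; have := gamma_adj x a; rewrite x0 rdot0l mulr0 => gx.
by apply/eqP; rewrite -sqrf_eq0 eq_le gx sqr_ge0.
Qed.

Lemma adjoint_single : single_valued Cs.
Proof.
move=> v d1 d2 h1 h2; apply/eqP; rewrite -subr_eq0; apply/eqP.
apply: (dense_orth0 C_dense); apply/orth_rdot => u [c Cu].
by rewrite rdotC rdotDr rdotNr -(adjoint_rdot Cu h1) -(adjoint_rdot Cu h2) subrr.
Qed.

Lemma opA_single : single_valued A.
Proof.
move=> [u v] [f1 g1] [f2 g2] /opAE[Cu1 Cv1] /opAE[Cu2 Cv2].
have /oppr_inj -> := C_single Cu1 Cu2.
by have /addIr -> := adjoint_single Cv1 Cv2.
Qed.

Lemma ker_opA u v : A ((u, v), 0) <-> [/\ C (u, 0), Cs (v, 0) & gamma u = 0].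
Proof.
split=> [Auv|[Cu Cv gu]].
  have := opA_energy Auv; rewrite rdot0l => /esym/eqP; rewrite oppr_eq0 => /eqP.
  move=> /gamma_eq0 /= gu.
  by move: Auv => /opAE; rewrite oppr0 add0r gu => -[].
by apply/opAE; rewrite oppr0 add0r gu.
Qed.

Lemma opA_closed : closed (A : set (hprod (hprod H0 H1) (hprod H0 H1))).
Proof.
apply: seq_closed => p [[u v] [f g]] Ap /cvg_hprod[/cvg_hprod/= [pu pv]].
move=> /cvg_hprod/= [pf pg].
have Ap' n : A (((p n).1.1, (p n).1.2), ((p n).2.1, (p n).2.2)).
  by have := Ap n; case: (p n) => [[? ?] [? ?]].
apply/opAE; split.
  apply: (linrel_closed_seq C_closed _ pu (cvgN pg)) => n.
  by have /opAE[] := Ap' n.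
apply/rdot_adjoint => w c Cw.
have lim1 : (fun n => rdot ((p n).1.2) c) @ \oo --> rdot v c by exact: cvg_rdot.
have lim2 : (fun n => rdot ((p n).2.1 + gamma (p n).1.1) w) @ \oo
    --> rdot (f + gamma u) w.
  by apply: cvg_rdot; apply: cvgD => //; exact: cvg_bop.
rewrite (rdotC c) (rdotC w); apply: cvg_unique lim1 _ => //.
rewrite (_ : (fun _ => _) = (fun n => rdot ((p n).2.1 + gamma (p n).1.1) w))//.
apply/funext => n; have /opAE[_ Cv] := Ap' n.
by rewrite rdotC (adjoint_rdot Cw Cv) rdotC.
Qed.

Lemma ker_ran_orth z r : A (z, 0) -> ran A r -> rdot r z = 0.
Proof.
case: z => u v /ker_opA[Cu Cv gu] [[u' v'] ]; case: r => f g /opAE[Cu' Cv'].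
rewrite rdot_hprod/=.
have := adjoint_rdot Cu Cv'; rewrite rdot0l rdotDr (rdotC u) (rdotC u).
have := adjoint_rdot Cu' Cv; rewrite rdot0r rdotNl.
by have := gamma_ker_orth u' gu; lra.
Qed.

Lemma ran_orth_ker r : ran A r -> orth (ker A) r.
Proof. by move=> Ar; apply/orth_rdot => z Az; exact: ker_ran_orth. Qed.

(** Let [z = (a, b)]. Pairing with the images of the vectors [(0, v)] gives
    [C a = 0], as [C] is its own biadjoint. Pairing with the image of [(a, 0)]
    then leaves [<gamma a, a> = 0], so that [gamma a = 0], and the images of the
    remaining vectors [(u, 0)] show that the adjoint of [C] vanishes at [b]. *)
Lemma orth_ran_ker z : orth (ran A) z -> A (z, 0).
Proof.
case: z => a b /orth_rdot zA.
have Ca : C (a, 0).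
  apply: biadjoint => // v d Cv; rewrite rdot0r.
  have := zA (d, 0); rewrite rdot_hprod/= rdot0r addr0 (rdotC a); apply.
  exists (0, v); apply/opAE; rewrite oppr0 linear0 addr0; split=> //.
  exact: (lsubspace0 C).
have Au u c : C (u, c) -> rdot (gamma u) a + rdot c b = 0.
  move=> Cu; have := zA (- gamma u, - c); rewrite rdot_hprod/= !rdotNr.
  rewrite (rdotC a) (rdotC b) => H; suff : - rdot (gamma u) a - rdot c b = 0 by lra.
  apply: H; exists (u, 0); apply/opAE; rewrite opprK addNr; split=> //.
  exact: (lsubspace0 Cs).
have ga : gamma a = 0.
  by apply: gamma_eq0; have := Au a 0 Ca; rewrite rdot0l addr0.
apply/ker_opA; split=> //; apply/rdot_adjoint => u c /Au.
by rewrite gamma_ker_orth// add0r rdot0r.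
Qed.

(** The range of [1 - h A] is closed by dissipativity. If [(a, b)] is orthogonal to
    it, then pairing with the images of the vectors [(0, v)] gives
    [C a = h^-1 b], and pairing with that of [(a, 0)] gives
    [<a, a> + h <gamma a, a> + <b, b> = 0]. *)
Lemma opA_max (h : R) f : 0 < h -> exists z r, A (z, r) /\ z - h%:C *: r = f.
Proof.
move=> h0; pose Rset : set (hprod H0 H1) :=
  [set w | exists z r, A (z, r) /\ z - h%:C *: r = w].
have R0 : Rset 0.
  by exists 0, 0; split; [exact: (lsubspace0 A)|rewrite scaler0 subr0].
have RP (a : R[i]) w w' : Rset w -> Rset w' -> Rset (a *: w + w').
  move=> [z [r [Az <-]]] [z' [r' [Az' <-]]].
  exists (a *: z + z'), (a *: r + r'); split; first exact: (lsubspaceP (l := A) a Az Az').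
  by rewrite scalerBr scalerDr !scalerA mulrC opprD addrACA.
pose S := LSubspace R0 RP.
have cX := hprod_complete cH0 cH1.
have cS : closed (S : set (hprod H0 H1)).
  apply: seq_closed => w l wS wl.
  have /choice[zr zrP] n : exists zr : hprod H0 H1 * hprod H0 H1,
      A (zr.1, zr.2) /\ zr.1 - h%:C *: zr.2 = w n.
    by have [z [r zr]] := wS n; exists (z, r).
  have [z zl] : exists z : hprod H0 H1, (fun n => (zr n).1) @ \oo --> z.
    apply: cX => e e0; have [N NP] := cvg_seq_cauchy wl e0.
    exists N => m n Nm Nn; apply: le_lt_trans (NP m n Nm Nn).
    have [Am <-] := zrP m; have [An <-] := zrP n.
    have := dissip_expand opA_dissipative (ltW h0) (linrelB Am An).
    rewrite (_ : _ - h%:C *: _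
      = (zr m).1 - h%:C *: (zr m).2 - ((zr n).1 - h%:C *: (zr n).2))//.
    by vector_ring.
  have rl : (fun n => (zr n).2) @ \oo --> h^-1%:C *: (z - l).
    rewrite (_ : (fun _ => _) = (fun n => h^-1%:C *: ((zr n).1 - w n))).
      by apply: cvgZl_tmp; exact: cvgB.
    apply/funext => n; have [_ <-] := zrP n.
    by rewrite opprB addrC subrK scalerA -rmorphM/= mulVf ?gt_eqF// scale1r.
  exists z, (h^-1%:C *: (z - l)); split; last first.
    by rewrite scalerA -rmorphM/= mulfV ?gt_eqF// scale1r opprB addrC subrK.
  apply: (linrel_closed_seq opA_closed _ zl rl) => n.
  by have [] := zrP n.
have [p [pS /orth_rdot po]] := projection cX f cS.
case oE : (f - p) po => [a b] po.
have Cab : C (a, h^-1%:C *: b).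
  apply: biadjoint => // v d Cv; rewrite rdotZr.
  have := po ((0, v) - h%:C *: ((d, 0) : hprod H0 H1)).
  rewrite rdotDr rdotNr rdotZr !rdot_hprod/= rdot0r add0r rdot0r addr0 => H.
  have : rdot b v - h * rdot a d = 0.
    apply: H; exists (0, v), (d, 0); split=> //; apply/opAE.
    by rewrite oppr0 linear0 addr0; split=> //; exact: (lsubspace0 C).
  rewrite (rdotC b) (rdotC a) => /eqP; rewrite subr_eq0 => /eqP ->.
  by rewrite mulKf// gt_eqF.
have := po ((a, 0) - h%:C *: ((- gamma a, - (h^-1%:C *: b)) : hprod H0 H1)).
rewrite rdotDr rdotNr rdotZr !rdot_hprod/= rdot0r addr0 !rdotNr rdotZr => H.
have : rdot a a - h * (- rdot a (gamma a) - h^-1 * rdot b b) = 0.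
  apply: H; exists (a, 0), (- gamma a, - (h^-1%:C *: b)); split=> //.
  apply/opAE; rewrite opprK addNr; split=> //.
  exact: (lsubspace0 Cs).
rewrite mulrBr mulrA mulfV ?gt_eqF// mul1r mulrN opprB opprK (rdotC a (gamma a)) => aab.
have hq := mulr_ge0 (ltW h0) (gamma_ge0 a).
have := rdot_ge0 a; have := rdot_ge0 b => b0 a0.
have a00 : a = 0 by apply: rdot_eq0; lra.
have b00 : b = 0 by apply: rdot_eq0; lra.
have -> : f = p by apply/eqP; rewrite -subr_eq0 oE a00 b00.
exact: pS.
Qed.

(** A normalized sequence in the complement of [ker C] with images tending to zero
    would have, by compactness, a limit of norm one in [ker C]. *)
Lemma C_below : exists M : R, 0 <= M /\
  forall u c, C (u, c) -> orth (ker C) u -> rnorm u <= M * rnorm c.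
Proof.
apply: below_of_seq => [a u|u c Cu uK u1 c1].
  exact: (lsubspaceZ (S := orth (ker C))).
have [k [x [kn ux]]] : has_cvg_subseq u.
  apply: (compactly_embedded_subseq (B := 1) C_compact uK Cu) => n.
    by rewrite u1.
  by apply: le_trans (c1 n) _; rewrite invf_le1// ler1n.
have c0 : c @ \oo --> (0 : H1).
  by apply: (cvg_seq_squeeze (@cvg_harmonic R)) => n; rewrite subr0.
have Cx : C (x, 0).
  apply: (linrel_closed_seq C_closed _ ux (cvg_subseq kn c0)) => n.
  exact: Cu.
have xK : orth (ker C) x.
  by apply: (closed_seq (orth_closed (S := ker C)) _ ux) => n; exact: uK.
have x1 : rnorm x = 1.
  apply: cvg_unique (cvg_rnorm ux) _ => //.
  rewrite (_ : (fun _ => _) = fun=> 1); first exact: cvg_cst.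
  by apply/funext => n /=.
by move: x1; rewrite (orth_self (S := ker C) Cx xK) rnorm0; lra.
Qed.

Lemma undamped0 : C (0, 0) /\ gamma 0 = 0.
Proof. by split; [exact: (lsubspace0 C)|exact: linear0]. Qed.

Lemma undampedP (a : R[i]) x y : C (x, 0) /\ gamma x = 0 ->
  C (y, 0) /\ gamma y = 0 -> C (a *: x + y, 0) /\ gamma (a *: x + y) = 0.
Proof.
move=> [Cx gx] [Cy gy]; split; first exact: (lsubspaceP (l := ker C) a Cx Cy).
by rewrite linearP gx gy scaler0 addr0.
Qed.

(** This is also the kernel of the compression of [gamma] to [ker C], as
    [<gamma x, x> = 0] implies [gamma x = 0]. *)
Definition undamped : lsubspace H0 :=
  @LSubspace _ _ [set x | C (x, 0) /\ gamma x = 0] undamped0 undampedP.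

Local Notation compression := (lr_comp
  (adjoint (graph (embedding (ker C))))
  (lr_comp (graph gamma) (graph (embedding (ker C))))).
Hypothesis compression_closed : closed (ran compression : set (subsp (ker C))).

(** If [gamma] were not bounded below, normalized vectors [x n] with
    [gamma (x n)] small, rescaled to norm [sqrt n.+1], would still be weakly
    bounded: they are orthogonal to [undamped], and their inner products with the
    range of the compression are controlled by the dissipated energy. As that
    range is closed, every vector is a sum of these two kinds. *)
Lemma gamma_below : exists M : R, 0 <= M /\
  forall x, C (x, 0) -> orth undamped x -> rnorm x <= M * rnorm (gamma x).
Proof.
pose S : set H0 := [set x | C (x, 0) /\ orth undamped x].
suff [M [M0 MP]] : exists M : R, 0 <= M /\
    forall x y, graph gamma (x, y) -> S x -> rnorm x <= M * rnorm y.
  by exists M; split=> // x Cx xu; apply: MP (erefl : graph gamma (x, gamma x)) _.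
apply: below_of_seq => [a x [Cx xu]|x y xy xS x1 y1].
  split; first exact: (lsubspaceZ (S := ker C)).
  exact: (lsubspaceZ (S := orth undamped)).
have gy n : gamma (x n) = y n by have /= := xy n.
have q_le n : rdot (gamma (x n)) (x n) <= n.+1%:R^-1.
  by apply: le_trans (rdot_le _ _) _; rewrite gy x1 mulr1; exact: y1.
pose s n : R := Num.sqrt n.+1%:R.
have s0 n : 0 <= s n by exact: sqrtr_ge0.
have ss n : s n ^+ 2 = n.+1%:R by rewrite sqr_sqrtr.
have /choice[xi xiE] n : exists z : subsp (ker C), subsp_val z = (s n)%:C *: x n.
  by apply: subsp_ex; apply: (lsubspaceZ (S := ker C)); have [] := xS n.
have cK : seq_complete (subsp (ker C)).
  by apply: subsp_complete => //; exact: ker_closed.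
pose W := ran compression.
have W_dot w : W w -> exists a : H0, forall z : subsp (ker C),
    rdot w z = rdot (gamma a) (subsp_val z).
  move=> [a [b [c /= -> ->] aw]]; exists (subsp_val a) => z.
  have wb := (rdot_adjoint (graph (embedding (ker C))) _ _).1 aw.
  by rewrite rdotC -(wb z (subsp_val z) erefl) rdotC.
have W_ex (a : subsp (ker C)) : exists2 w, W w &
    forall z, rdot w z = rdot (gamma (subsp_val a)) (subsp_val z).
  have [w aw] := bop_adjoint (embedding (ker C)) (gamma (subsp_val a)) cK.
  exists w; first by exists a, (gamma (subsp_val a)) => //; exists (subsp_val a).
  move=> z; have := (rdot_adjoint _ _ _).1 aw z (subsp_val z) erefl.
  by rewrite (rdotC w) (rdotC (gamma _)) => ->.
have bounded (w : subsp (ker C)) : exists B, forall n, rdot w (xi n) <= B.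
  have [p [/W_dot[a pE] /orth_rdot oW]] := projection cK w compression_closed.
  set o := w - p in oW.
  have [m mW mE] := W_ex o.
  have uo : undamped (subsp_val o).
    split; first exact: (subsp_valS o).
    by apply: gamma_eq0; rewrite -mE rdotC; exact: oW.
  exists (K * rnorm a ^+ 2 + 1) => n.
  have -> : rdot w (xi n) = rdot (gamma a) (subsp_val (xi n)).
    rewrite -pE -[w](subrK p) -/o rdotDl.
    have [_ /orth_rdot xu] := xS n.
    suff -> : rdot o (xi n) = 0 by rewrite add0r.
    rewrite -[rdot o _]/(rdot (subsp_val o) (subsp_val (xi n))) xiE.
    by rewrite rdotZr rdotC xu// mulr0.
  rewrite xiE rdotZr; set b := rdot (gamma a) (x n).
  have bb : (s n * b) ^+ 2 <= K * rnorm a ^+ 2.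
    rewrite exprMn ss; have := gamma_adj (x n) a; rewrite -/b => bq.
    apply: le_trans (ler_wpM2l (ler0n R n.+1) bq) _.
    rewrite mulrCA ler_piMr//; first by rewrite mulr_ge0// sqr_ge0.
    by rewrite -ler_pdivlMl// mulr1.
  move: bb; set t := s n * b; have := sqr_ge0 t; have := sqr_ge0 (t - 1).
  by rewrite sqrrB expr1n mulr1; lra.
have [B BP] := weakly_bounded cK bounded.
have xn n : n.+1%:R <= B ^+ 2.
  rewrite -ss; have := BP n; rewrite -rnorm_subsp xiE rnormZ x1 mulr1.
  by rewrite ger0_norm// => sB; rewrite ler_pXn2r ?nnegrE// (le_trans (s0 n)).
by have := xn (Num.truncn (B ^+ 2)); rewrite leNgt truncnS_gt.
Qed.

(** The key compactness property. The components of [z n] off the kernels of [C]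
    and of its adjoint converge along a subsequence, by the compact embedding and
    by duality. The remaining component, in [ker C], is recovered from its image
    under [gamma], which converges because [gamma (u n)] tends to zero with the
    dissipated energy. *)
Lemma opA_compact (z r : nat -> hprod H0 H1) (B : R) :
  (forall n, A (z n, r n)) -> (forall n, orth (ker A) (z n)) ->
  (forall n, rnorm (z n) <= B) -> (forall n, rnorm (r n) <= B) ->
  (fun n => rdot (gamma (z n).1) (z n).1) @ \oo --> (0 : R) ->
  has_cvg_subseq z.
Proof.
move=> Azr zK zB rB q0.
have B0 : 0 <= B by apply: le_trans (zB 0%N); exact: rnorm_ge0.
pose u n := (z n).1; pose v n := (z n).2.
pose c n := - (r n).2; pose d n := (r n).1 + gamma (u n).
have AE n : C (u n, c n) /\ Cs (v n, d n).
  have : A ((u n, v n), ((r n).1, (r n).2)).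
    by have := Azr n; rewrite /u /v; case: (z n) (r n) => [? ?] [? ?].
  by move=> /opAE.
have zu n : rnorm (u n) <= B.
  by have [a _ _] := rnorm_hprod_le (z n); exact: le_trans a (zB n).
have zv n : rnorm (v n) <= B.
  by have [_ a _] := rnorm_hprod_le (z n); exact: le_trans a (zB n).
have rc n : rnorm (c n) <= B.
  by have [_ a _] := rnorm_hprod_le (r n); rewrite rnormN; exact: le_trans a (rB n).
have [G G0 gG] := bop_rnorm gamma.
have rd n : rnorm (d n) <= B + G * B.
  apply: le_trans (rnormD _ _) _; apply: lerD.
    by have [a _ _] := rnorm_hprod_le (r n); exact: le_trans a (rB n).
  by apply: le_trans (gG _) _; rewrite ler_wpM2l.
have [M [M0 MP]] := C_below.
have off_ker a y : C (a, y) -> exists a', [/\ C (a', y), C (a - a', 0) & orth (ker C) a'].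
  move=> Cay; have [p [Cp po]] := projection cH0 a (ker_closed C_closed).
  exists (a - p); split=> //; last by rewrite opprB addrCA subrr addr0.
  by have := linrelB Cay Cp; rewrite subr0.
have /choice[w wP] n := off_ker _ _ (AE n).1.
have Cw n : C (w n, c n) by have [] := wP n.
have wK n : orth (ker C) (w n) by have [] := wP n.
have /choice[e eP] n : exists e, C (e, v n) /\ orth (ker C) e.
  have [p [Cp /orth_rdot po]] := projection cH1 (v n) ran_C_closed.
  have o0 : v n - p = 0.
    apply: rdot_eq0; rewrite {2}[v n - p]addrC rdotDr rdotNr po// oppr0 add0r.
    have Ao : A ((0, v n - p), 0).
      apply/ker_opA; split; [exact: (lsubspace0 C)| |exact: linear0].
      apply/rdot_adjoint => a b Cab; rewrite rdot0r rdotC; apply: po.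
      by exists a.
    have := (orth_rdot _ _).1 (zK n) _ Ao.
    by rewrite rdot_hprod/= rdot0r add0r rdotC.
  have [a Ca] : ran C (v n) by move/eqP: o0; rewrite subr_eq0 => /eqP ->.
  by have [e [Ce _ eK]] := off_ker _ _ Ca; exists e.
have Ce n : C (e n, v n) by have [] := eP n.
have eK n : orth (ker C) (e n) by have [] := eP n.
pose D := Num.max B (M * B).
have wD n : rnorm (w n) <= D.
  rewrite le_max; apply/orP; right; apply: le_trans (MP _ _ (Cw n) (wK n)) _.
  by rewrite ler_wpM2l.
have eD n : rnorm (e n) <= D.
  rewrite le_max; apply/orP; right; apply: le_trans (MP _ _ (Ce n) (eK n)) _.
  by rewrite ler_wpM2l.
have [k1 [w1 [k1n ww1]]] : has_cvg_subseq w.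
  apply: (compactly_embedded_subseq (B := D) C_compact wK Cw) => // n.
  by rewrite le_max rc.
have [k2 [e1 [k2n ee1]]] : has_cvg_subseq (e \o k1).
  apply: (compactly_embedded_subseq (B := D) (v := v \o k1) C_compact) => n /=.
  - exact: eK.
  - exact: Ce.
  - exact: eD.
  - by rewrite le_max zv.
pose k := k1 \o k2.
have kn n : (n <= k n)%N by apply: leq_trans (k2n n) (k1n _).
have wk : w \o k @ \oo --> w1 by exact: (cvg_subseq k2n ww1).
have ek : e \o k @ \oo --> e1 by exact: ee1.
(* By duality [<v m - v n, v m - v n>] is the inner product of [e m - e n] with
   the bounded vector [d m - d n]. *)
have [v1 vk] : exists v1 : H1, v \o k @ \oo --> v1.
  apply: cH1 => eps eps0.
  pose D2 := 2 * (B + G * B) + 1.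
  have D20 : 0 < D2 by have := mulr_ge0 G0 B0; rewrite /D2; lra.
  have e20 : 0 < eps ^+ 2 / D2 by rewrite divr_gt0 ?exprn_gt0.
  have [N NP] := cvg_seq_cauchy ek e20.
  exists N => m n Nm Nn; have := NP m n Nm Nn; rewrite ltr_pdivlMr// => ed.
  rewrite -(@ltr_pXn2r _ 2) ?nnegrE ?rnorm_ge0 ?(ltW eps0)// rnormK.
  have := adjoint_rdot (linrelB (Ce (k m)) (Ce (k n)))
    (linrelB (AE (k m)).2 (AE (k n)).2).
  rewrite /= => ->; apply: le_lt_trans (rdot_le _ _) _; apply: le_lt_trans ed.
  rewrite ler_wpM2l ?rnorm_ge0//; apply: le_trans (rnormD _ _) _; rewrite rnormN.
  by have := rd (k m); have := rd (k n); rewrite /D2; lra.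
have g0 : (fun n => gamma (u n)) @ \oo --> (0 : H0).
  apply/cvg_seq_lt => eps eps0.
  have K1 : 0 < K + 1 by rewrite ltr_wpDl.
  have e20 : 0 < eps ^+ 2 / (K + 1) by rewrite divr_gt0 ?exprn_gt0.
  have [N _ NP] := cvgr0_norm_lt _ q0 _ e20.
  exists N => n /NP; rewrite subr0 ger0_norm// ltr_pdivlMr// => qe.
  rewrite -(@ltr_pXn2r _ 2) ?nnegrE ?rnorm_ge0 ?(ltW eps0)//.
  apply: le_lt_trans (gamma_bound _) _; apply: le_lt_trans qe.
  by rewrite mulrC ler_wpM2l//; lra.
pose x n := u n - w n.
have Cx n : C (x n, 0) by have [] := wP n.
have xu n : orth undamped (x n).
  apply/orth_rdot => y [Cy gy].
  have Ay : A ((y, 0), 0) by apply/ker_opA; split=> //; exact: (lsubspace0 Cs).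
  have := (orth_rdot _ _).1 (zK n) _ Ay.
  rewrite rdot_hprod/= rdot0r addr0 -/(u n) rdotDl rdotNl => ->.
  by rewrite ((orth_rdot _ _).1 (wK n) y Cy) subr0.
have [M' [M'0 M'P]] := gamma_below.
have [x1 xk] : exists x1 : H0, x \o k @ \oo --> x1.
  apply: cH0 => eps eps0.
  have gx : (fun n => gamma ((x \o k) n)) @ \oo --> (0 - gamma w1 : H0).
    rewrite (_ : (fun _ => _) = (fun n => gamma ((u \o k) n) - gamma ((w \o k) n))).
      by apply: cvgB; [exact: (cvg_subseq kn g0)|exact: cvg_bop].
    by apply/funext => n; rewrite /= /x linearB.
  have M1 : 0 < M' + 1 by lra.
  have [N NP] := cvg_seq_cauchy gx (divr_gt0 eps0 M1).
  exists N => m n Nm Nn; have := NP m n Nm Nn; rewrite ltr_pdivlMr//.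
  apply: le_lt_trans; rewrite -linearB.
  have Cd := linrelB (Cx (k m)) (Cx (k n)); rewrite subr0 in Cd.
  apply: le_trans (M'P _ Cd _) _.
    exact: (lsubspaceB (S := orth undamped)).
  by rewrite mulrC ler_wpM2l ?rnorm_ge0//; lra.
exists k, (x1 + w1, v1); split=> //; apply/cvg_hprod; split=> //=.
rewrite (_ : (fun _ => _) = (fun n => (x \o k) n + (w \o k) n)); first exact: cvgD.
by apply/funext => n; rewrite /= /x subrK.
Qed.

(** As for [C_below], with [opA_compact] as the source of compactness: images
    tending to zero force the dissipated energy to zero. *)
Lemma opA_below : exists M : R, 0 <= M /\
  forall z r, A (z, r) -> orth (ker A) z -> rnorm z <= M * rnorm r.
Proof.
apply: below_of_seq => [a z|z r Azr zK z1 r1].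
  exact: (lsubspaceZ (S := orth (ker A))).
have rB n : rnorm (r n) <= 1.
  by apply: le_trans (r1 n) _; rewrite invf_le1// ler1n.
have r0 : r @ \oo --> (0 : hprod H0 H1).
  by apply: (cvg_seq_squeeze (@cvg_harmonic R)) => n; rewrite subr0.
have [k [l [kn zl]]] : has_cvg_subseq z.
  apply: (opA_compact (B := 1) Azr zK) => [n|n|]; rewrite ?z1//.
  apply: (squeeze_cvgr _ (cvg_cst 0) (@cvg_harmonic R)); apply: nearW => n.
  rewrite gamma_ge0 /harmonic/= -[leLHS]opprK -(opA_energy (Azr n)) -rdotNl.
  by apply: le_trans (rdot_le _ _) _; rewrite rnormN z1 mulr1.
have Al : A (l, 0).
  by apply: (linrel_closed_seq opA_closed _ zl (cvg_subseq kn r0)) => n; exact: Azr.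
have lK : orth (ker A) l.
  by apply: (closed_seq (orth_closed (S := ker A)) _ zl) => n; exact: zK.
have l1 : rnorm l = 1.
  apply: cvg_unique (cvg_rnorm zl) _ => //.
  rewrite (_ : (fun _ => _) = fun=> 1); first exact: cvg_cst.
  by apply/funext => n /=.
by move: l1; rewrite (orth_self (S := ker A) Al lK) rnorm0; lra.
Qed.

Lemma opA_reduce z r : A (z, r) -> exists z', A (z', r) /\ orth (ker A) z'.
Proof.
move=> Azr.
have [p [Ap po]] := projection (hprod_complete cH0 cH1) z (ker_closed opA_closed).
by exists (z - p); split=> //; have := linrelB Azr Ap; rewrite subr0.
Qed.

Lemma ran_opA_closed : closed (ran A : set (hprod H0 H1)).
Proof.
apply: seq_closed => r l rA rl; have [M [M0 MP]] := opA_below.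
have /choice[z zP] n : exists z, A (z, r n) /\ orth (ker A) z.
  by have [z Az] := rA n; exact: opA_reduce Az.
have [y zy] : exists y : hprod H0 H1, z @ \oo --> y.
  apply: (hprod_complete cH0 cH1) => e e0.
  have M1 : 0 < M + 1 by lra.
  have [N NP] := cvg_seq_cauchy rl (divr_gt0 e0 M1).
  exists N => m n Nm Nn; have := NP m n Nm Nn; rewrite ltr_pdivlMr//.
  have [Am Km] := zP m; have [An Kn] := zP n.
  apply: le_lt_trans; apply: le_trans (MP _ _ (linrelB Am An) _) _.
    exact: (lsubspaceB (S := orth (ker A))).
  by rewrite mulrC ler_wpM2l ?rnorm_ge0//; lra.
exists y; apply: (linrel_closed_seq opA_closed _ zy rl) => n.
by have [] := zP n.
Qed.

(** The component of [z] orthogonal to the closed range lies in [ker A], while [z]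
    and the component in the range are orthogonal to [ker A]. *)
Lemma orth_ker_ran z : orth (ker A) z -> ran A z.
Proof.
move=> zK.
have [p [Ap po]] := projection (hprod_complete cH0 cH1) z ran_opA_closed.
have pK := ran_orth_ker Ap.
have o0 := orth_self (S := ker A) (orth_ran_ker po)
  (lsubspaceB (S := orth (ker A)) zK pK).
by move/eqP: o0; rewrite subr_eq0 => /eqP ->.
Qed.

Local Notation A0 := (opA0 C gamma).

Lemma opA0E (x y : subsp (ran A)) :
  A0 (x, y) <-> A (subsp_val x, subsp_val y).
Proof.
split=> [[]//|Axy]; split=> //=.
by apply: ran_orth_ker; exact: subsp_valS.
Qed.

Lemma opA0_generator : exists T : R -> bop (subsp (ran A)) (subsp (ran A)),
  contraction_semigroup T /\
  generator T = A0 :> set (hprod (subsp (ran A)) (subsp (ran A))).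
Proof.
apply: lumer_phillips.
- exact: subsp_complete (hprod_complete cH0 cH1) ran_opA_closed.
- move=> x y1 y2 /opA0E h1 /opA0E h2; apply: subsp_valI.
  exact: opA_single h1 h2.
- by move=> x y /opA0E /opA_dissipative.
- move=> h h0 f; have [z [r [Azr zE]]] := opA_max (subsp_val f) h0.
  have rA : ran A r by exists z.
  have zA : ran A z.
    have -> : z = subsp_val f + h%:C *: r by rewrite -zE subrK.
    exact: (lsubspaceD (S := ran A) (subsp_valS f) (lsubspaceZ (S := ran A) _ rA)).
  have [y yE] := subsp_ex rA; have [x xE] := subsp_ex zA.
  exists x, y; split; first by apply/opA0E; rewrite xE yE.
  by apply: subsp_valI; rewrite subsp_valB subsp_valZ xE yE.
Qed.

Lemma opA0_stable (T : R -> bop (subsp (ran A)) (subsp (ran A))) :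
  (forall (lambda : R) z, lambda != 0 ->
    A (z, ('i%C * lambda%:C) *: z) -> z = 0) ->
  contraction_semigroup T ->
  generator T = A0 :> set (hprod (subsp (ran A)) (subsp (ran A))) ->
  semi_uniformly_stable T.
Proof.
move=> A_point T_contr TA.
have TE x y : generator T (x, y) <-> A (subsp_val x, subsp_val y).
  by rewrite -opA0E /lsubspace_mem TA.
have [M [M0 MP]] := opA_below.
apply: (semi_uniform_stability T_contr (M := M)).
- move=> y; have [z Az] := subsp_valS y; have [z' [Az' zK]] := opA_reduce Az.
  by have [x xE] := subsp_ex (orth_ker_ran zK); exists x; apply/TE; rewrite xE.
- move=> x y /TE Axy; rewrite -!rnorm_subsp; apply: MP Axy _.
  by apply: ran_orth_ker; exact: subsp_valS.
- move=> x y B Axy xB yB q0.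
  have Axy' n : A (subsp_val (x n), subsp_val (y n)) by exact/TE.
  have [||||k [l [kn xl]]] := opA_compact (B := B) Axy'.
  + by move=> n; apply: ran_orth_ker; exact: subsp_valS.
  + by move=> n; rewrite rnorm_subsp.
  + by move=> n; rewrite rnorm_subsp.
  + rewrite (_ : (fun _ => _) = (fun n => - rdot (y n) (x n))).
      by rewrite -[X in _ --> X]oppr0; exact: cvgN.
    apply/funext => n; rewrite -[LHS]opprK -(opA_energy (Axy' n)); congr (- _).
  have [l' l'E] : exists l' : subsp (ran A), subsp_val l' = l.
    apply: subsp_ex; apply: (closed_seq ran_opA_closed _ xl) => n.
    exact: (subsp_valS (x (k n))).
  by exists k, l'; split=> //; apply/cvg_subsp; rewrite l'E.
- move=> lambda x l0 /TE; rewrite subsp_valZ => /(A_point _ _ l0) x0.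
  by apply: subsp_valI; rewrite x0 subsp_val0.
Qed.

End BlockOperator.

Theorem theorem4p6 (R : realType) (H0 H1 : hilbertType R)
    (C : linrel H0 H1) (gamma : bop H0 H0)
    (C_single_valued : single_valued C)
    (C_densely_defined : dense (dom C : set H0))
    (C_closed : closed (C : set (hprod H0 H1)))
    (ran_C_closed : closed (ran C : set H1))
    (C_compact : compactly_embedded C (orth (ker C)))
    (gamma_ge0 : lr_ge (lr_Re (graph gamma)) 0)
    (gamma_split :
      exists (U : lsubspace H0) (c : R)
          (gammaU : bop (subsp U) (subsp U))
          (gammaV : bop (subsp (orth U)) (subsp (orth U))),
        [/\ closed (U : set H0),
            0 < c,
            lr_ge (lr_Re (graph gammaU)) c,
            graph gammaV = adjoint (graph gammaV)
              :> set (hprod (subsp (orth U)) (subsp (orth U))) /\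
            lr_ge (graph gammaV) 0 &
            forall (x : subsp U) (y : subsp (orth U)),
              gamma (subsp_val x + subsp_val y) =
              subsp_val (gammaU x) + subsp_val (gammaV y)])
    (A := opA C gamma)
    (hyp_a : forall lambda : R, lambda != 0 ->
      one_to_one (lr_add (lr_scalar _ ('i%C * lambda%:C)) (lr_opp A)) /\
      one_to_one (lr_add (lr_scalar _ ('i%C * lambda%:C))
                         (lr_opp (adjoint A))))
    (kappa0 := embedding (ker C))
    (hyp_b : closed (ran (lr_comp (adjoint (graph kappa0))
                            (lr_comp (graph gamma) (graph kappa0)))
                     : set (subsp (ker C)))) :
  [/\ closed (ran A : set (hprod H0 H1)),
      (dom A : set (hprod H0 H1)) `&` orth (ker A) `<=` ran A &
      exists T : R -> bop (subsp (ran A)) (subsp (ran A)),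
        [/\ C0_semigroup T,
            generator T = opA0 C gamma
              :> set (hprod (subsp (ran A)) (subsp (ran A))) &
            semi_uniformly_stable T]].

Proof.
have [U [c [gammaU [gammaV [cU c0 gU [gV_sym gV0] gE]]]]] := gamma_split.
have cH0 := @hilbert_complete R H0.
have [K [K0 KP]] := damping_bounds cH0 cU c0 gU gV_sym gV0 gE.
have gamma_ge x : 0 <= rdot (gamma x) x by have [] := KP x.
have gamma_bd x : rnorm (gamma x) ^+ 2 <= K * rdot (gamma x) x by have [] := KP x.
have gamma_ad x a : rdot (gamma a) x ^+ 2 <= K * rnorm a ^+ 2 * rdot (gamma x) x.
  by have [_ _] := KP x; exact.
split.
- exact: (ran_opA_closed C_closed ran_C_closed C_compact K0 gamma_ge gamma_bd
    gamma_ad hyp_b).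
- move=> z [_ zK].
  exact: (orth_ker_ran C_closed ran_C_closed C_compact K0 gamma_ge gamma_bd
    gamma_ad hyp_b).
have [T [T_contr TA]] : exists T : R -> bop (subsp (ran A)) (subsp (ran A)),
    contraction_semigroup T /\
    generator T = opA0 C gamma :> set (hprod (subsp (ran A)) (subsp (ran A))).
  exact: (opA0_generator C_single_valued C_densely_defined
    C_closed ran_C_closed C_compact K0 gamma_ge gamma_bd
    gamma_ad hyp_b).
exists T; split=> //; first by have [] := T_contr.
apply: (opA0_stable C_closed ran_C_closed C_compact K0 gamma_ge gamma_bd
    gamma_ad hyp_b) => //.
move=> lambda z l0 Az.
have [inj _] := hyp_a lambda l0.
apply: (inj z 0 0).
- exists (('i%C * lambda%:C) *: z), (- (('i%C * lambda%:C) *: z)); split=> //.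
    by exists (('i%C * lambda%:C) *: z) => //; rewrite scaleN1r.
  by rewrite /= subrr.
- exists 0, 0; split; last by rewrite addr0.
    by rewrite /= scaler0.
  by exists 0; [exact: (lsubspace0 A)|rewrite scaler0].
Qed.
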